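(* Let $1\le r<\min\{n,m\}$ and let $\mathcal{C}=\{X\in\mathbb{R}^{n\times m}:\operatorname{rank}(X)\le r\}$. Then, with respect to the nuclear norm $\|\cdot\|=\|\cdot\|_{\mathrm{nuc}}$ and its dual, the spectral norm $\|\cdot\|^*=\|\cdot\|_{\mathrm{sp}}$, the set $\mathcal{C}$ has local concavity coefficients $$\gamma_X(\mathcal{C})=\frac{1}{2\sigma_r(X)}\quad\text{for all }X\in\mathcal{C}$$ (interpreted as $\infty$ when $\sigma_r(X)=0$), and $\mathcal{C}$ satisfies the norm compatibility condition with parameter $\phi=1$, i.e. $\|Z-P_{\mathcal{C}}(Z)\|_{\mathrm{sp}}\le\min_{X\in\mathcal{C}}\|Z-X\|_{\mathrm{sp}}$ for all $Z\in\mathbb{R}^{n\times m}$.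
   Context: $\sigma_1(X)\ge\sigma_2(X)\ge\dots$ are the singular values of $X$; $\|X\|_{\mathrm{nuc}}$ is their sum, $\|X\|_{\mathrm{sp}}=\sigma_1(X)$, $\|X\|_F$ is the Frobenius norm and $\langle\cdot,\cdot\rangle$ the trace inner product. $P_{\mathcal{C}}(Z)\in\arg\min_{X\in\mathcal{C}}\|X-Z\|_F$; if the minimizer is non-unique, $P_{\mathcal{C}}(Z)$ denotes any minimizer, claims involving it are to hold for every choice, and ''$P_{\mathcal{C}}(Z)=X$'' means that $X$ is a minimizer. Degenerate points: $\mathcal{C}_{\mathrm{dgn}}=\{X\in\mathcal{C}:P_{\mathcal{C}}\text{ is not continuous over any neighborhood of }X\}$. Local concavity coefficients: $\gamma_X(\mathcal{C})=\infty$ if $X\in\mathcal{C}_{\mathrm{dgn}}$, and for $X\in\mathcal{C}\setminus\mathcal{C}_{\mathrm{dgn}}$, $\gamma_X(\mathcal{C})$ is the smallest $\gamma\in[0,\infty]$ such that $\langle Y-X,Z-X\rangle\le\gamma\|Z-X\|^*\|Y-X\|_F^2$ for all $Y\in\mathcal{C}$ and all $Z\in\mathbb{R}^{n\times m}$ with $P_{\mathcal{C}}(Z)=X$. *)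

(* Defs.v *)
From HB Require Import structures.
From mathcomp Require Import all_boot all_order all_algebra.
From mathcomp Require polyrcf.
From mathcomp Require Import all_classical all_reals all_analysis.

Set Implicit Arguments.
Unset Strict Implicit.
Unset Printing Implicit Defensive.

Import Order.TTheory GRing.Theory Num.Theory.
Import numFieldNormedType.Exports.
Local Open Scope classical_set_scope.
Local Open Scope ring_scope.

Section MatrixNorms.
Context {R : realType} {n m : nat}.
Implicit Types X Y Z : 'M[R]_(n, m).

Definition inner X Y : R := \tr (X^T *m Y).

Definition frobenius_norm X : R := Num.sqrt (inner X X).

(* [rootsR p] lists the distinct real roots of [p]; each is repeated here
   according to its multiplicity. *)
Definition roots_with_mult (p : {poly R}) : seq R :=
  flatten [seq nseq (mup x p) x | x <- polyrcf.rootsR p].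

(* The square roots of the eigenvalues of X^T X, with multiplicity, in
   nonincreasing order.  The list has m entries; those beyond the first
   min(n, m) are zero. *)
Definition singular_values X : seq R :=
  sort (fun a b => b <= a)
    [seq Num.sqrt x | x <- roots_with_mult (char_poly (X^T *m X))].

(* Indexed from 1: [sigma 1 X] is the largest singular value.  The value is 0
   past the end of the list. *)
Definition sigma (k : nat) X : R := nth 0 (singular_values X) k.-1.

Definition nuclear_norm X : R := \sum_(s <- singular_values X) s.

Definition spectral_norm X : R := sigma 1 X.

Definition dual_norm (N : 'M[R]_(n, m) -> R) Z : R :=
  sup [set inner X Z | X in [set X | N X <= 1]].

End MatrixNorms.

Section LocalConcavity.
Context {R : realType} {n m : nat}.
Implicit Types (C : set 'M[R]_(n, m)) (X Y Z : 'M[R]_(n, m)).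
Implicit Types (N : 'M[R]_(n, m) -> R) (P : 'M[R]_(n, m) -> 'M[R]_(n, m)).

(* "P_C(Z) = X" in the multivalued sense: X is one of the minimizers. *)
Definition is_proj C Z X : Prop :=
  C X /\ forall Y, C Y -> frobenius_norm (X - Z) <= frobenius_norm (Y - Z).

(* P makes an arbitrary choice among the minimizers at each point; statements
   about P_C are quantified over all such P. *)
Definition projection_onto C P : Prop := forall Z, is_proj C Z (P Z).

Definition degenerate C P : set 'M[R]_(n, m) :=
  [set X | C X /\
           ~ exists U : set 'M[R]_(n, m), nbhs X U /\ {within U, continuous P}].

(* At g = +oo the bound uses the convention +oo * 0 = 0; the left-hand side
   also vanishes whenever the factor of g does. *)
Definition concavity_bounds N C X : set (\bar R) :=
  [set g : \bar R | (0 <= g)%E /\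
    forall Y Z, C Y -> is_proj C Z X ->
      ((inner (Y - X) (Z - X))%:E <=
       g * (dual_norm N (Z - X) * frobenius_norm (Y - X) ^+ 2)%:E)%E].

Lemma concavity_bounds_inf N C X : N 0 <= 1 -> concavity_bounds N C X !=set0 ->
  concavity_bounds N C X (ereal_inf (concavity_bounds N C X)).
Proof.
move=> N0 [g0 [g0_ge0 g0P]]; split.
  by apply: le_ereal_inf_tmp => g [].
move=> Y Z CY ZX.
have d_ge0 : 0 <= dual_norm N (Z - X).
  have [hs|hs] := pselect (has_sup [set inner W (Z - X) | W in [set W | N W <= 1]]).
    apply: ub_le_sup; first by case: hs.
    by exists 0 => //; rewrite /inner trmx0 mul0mx mxtrace0.
  by rewrite /dual_norm sup_out.
set c := _ * _ ^+ 2.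
have : 0 <= c by rewrite mulr_ge0 // sqr_ge0.
rewrite le_eqVlt => /orP[/eqP c0|c_gt0].
  by have := g0P Y Z CY ZX; rewrite -/c -c0 !mule0.
rewrite -lee_pdivrMr //; apply: le_ereal_inf_tmp => g [_ gP].
by rewrite lee_pdivrMr //; exact: gP.
Qed.

(* The infimum is the smallest admissible value, by [concavity_bounds_inf]. *)
Definition local_concavity_coeff N C P X : \bar R :=
  if `[< degenerate C P X >] then +oo%E else ereal_inf (concavity_bounds N C X).

(* Being at most phi times the minimum over C is stated as being at most phi
   times each of the values over C. *)
Definition norm_compatible N C P (phi : R) : Prop :=
  forall Z X, C X -> dual_norm N (Z - P Z) <= phi * dual_norm N (Z - X).

End LocalConcavity.

Definition rank_le {R : realType} (n m r : nat) : set 'M[R]_(n, m) :=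
  [set X | (\rank X <= r)%N].
Arguments rank_le {R} n m r _.

(* Main.v *)
Require Import Defs.
From HB Require Import structures.
From mathcomp Require Import all_boot all_order all_algebra.
From mathcomp Require Import perm ring lra zify.
From mathcomp Require polyrcf.
From mathcomp Require Import complex.
From mathcomp Require Import all_classical all_reals all_analysis.

Set Implicit Arguments.
Unset Strict Implicit.
Unset Printing Implicit Defensive.

Import Order.TTheory GRing.Theory Num.Theory.
Import numFieldNormedType.Exports.
Local Open Scope classical_set_scope.
Local Open Scope ring_scope.

(** The core is a separation inequality: if [X] has rank [r], [W] is orthogonal
    to [X] on both sides and [spectral_norm W <= sigma r X], then
    [2 <Y, W> <= |Y - X|^2] for every [Y] of rank at most [r].  Since
    [X + W - Y] cannot be smaller than [X + W] restricted to the orthogonal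
    complement of the row space of [Y], this is a Ky Fan type trace estimate
    for the projection onto that row space.  It says that [X] is a nearest
    point of [X + W], and, rescaled in [W], it is the upper bound
    [1 / (2 sigma r X)] on the concavity coefficient; with a strict gap
    [spectral_norm W < sigma r X] it makes the projection Lipschitz at
    [X + W], so [X] is not degenerate when [sigma r X > 0].

    Conversely every nearest point [X] of [Z] has this form: first-order
    variations [X + t A X] and [X + t X A] give the orthogonality of
    [W = Z - X], and exchanging singular triples gives
    [spectral_norm W <= sigma r X].  Hence [Z] expands by [spectral_norm W] on
    an [r+1]-dimensional space, which every [Y] of rank at most [r] meets in a
    kernel vector; this is norm compatibility.

    If [sigma r X = 0], approximate [X] by [Y] of rank [r - 1]: on
    [Y + a uv^T + b u'v'^T] the projection keeps the larger of the two small
    terms, so it jumps at [a = b]. *)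

(** * Spectral theorem for real symmetric matrices *)

Lemma mxtrace_mulmx_tr (R : realType) (n m : nat) (A : 'M[R]_(n, m)) :
  \tr (A *m A^T) = \sum_i \sum_j A i j ^+ 2.
Proof.
by apply: eq_bigr => i _; rewrite mxE; apply: eq_bigr => j _; rewrite mxE expr2.
Qed.

Lemma mxtrace_mulmx_tr_ge0 (R : realType) (n m : nat) (A : 'M[R]_(n, m)) :
  0 <= \tr (A *m A^T).
Proof.
by rewrite mxtrace_mulmx_tr; do 2 apply: sumr_ge0 => ? _; exact: sqr_ge0.
Qed.

Lemma mxtrace_mulmx_tr_eq0 (R : realType) (n m : nat) (A : 'M[R]_(n, m)) :
  \tr (A *m A^T) = 0 -> A = 0.
Proof.
rewrite mxtrace_mulmx_tr => /eqP; rewrite psumr_eq0; last first.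
  by move=> i _; apply: sumr_ge0 => ? _; exact: sqr_ge0.
move=> /allP A0; apply/matrixP => i j; rewrite mxE.
have := A0 i (mem_index_enum _); rewrite implyTb psumr_eq0; last first.
  by move=> ? _; exact: sqr_ge0.
by move=> /allP /(_ j (mem_index_enum _)); rewrite implyTb sqrf_eq0 => /eqP.
Qed.

(* For [v = x + iy] with eigenvalue [a + ib], symmetry computes [x S y^T] in
   two ways, which forces [b (|x|^2 + |y|^2) = 0]. *)
Lemma symmetric_eigenvector (R : realType) (m : nat) (S : 'M[R]_m.+1) :
  S^T = S -> exists (a : R) (x : 'rV[R]_m.+1), x != 0 /\ x *m S = a *: x.
Proof.
move=> Ssym; pose f := (real_complex R).
have [z] : exists z, root (char_poly (map_mx f S)) z.
  by apply/closed_rootP; rewrite size_char_poly.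
rewrite -eigenvalue_root_char => /eigenvalueP[v vS v0].
pose a := complex.Re z; pose b := complex.Im z.
pose x := map_mx (@complex.Re R) v; pose y := map_mx (@complex.Im R) v.
have xS : x *m S = a *: x - b *: y.
  apply/rowP => j; have := congr1 (fun M : 'rV[complex R]_m.+1 => complex.Re (M 0 j)) vS.
  rewrite !mxE raddf_sum /= => h.
  transitivity (complex.Re (z * v 0 j)); last by rewrite /a /b; case: (z) (v 0 j) => ? ? [].
  rewrite -h; apply: eq_bigr => k _; rewrite !mxE.
  by case: (v 0 k) => c d /=; rewrite mulr0 subr0.
have yS : y *m S = b *: x + a *: y.
  apply/rowP => j; have := congr1 (fun M : 'rV[complex R]_m.+1 => complex.Im (M 0 j)) vS.
  rewrite !mxE raddf_sum /= => h.
  transitivity (complex.Im (z * v 0 j)).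
    rewrite -h; apply: eq_bigr => k _; rewrite !mxE.
    by case: (v 0 k) => c d /=; rewrite mulr0 add0r mulrC mulrC.
  by rewrite /a /b; case: (z) (v 0 j) => ? ? [] ? ? /=; rewrite addrC.
have : \tr (x *m S *m y^T) = \tr (x *m (y *m S)^T).
  by rewrite trmx_mul Ssym mulmxA.
rewrite xS yS [(_ + _)^T]linearD /= ![(_ *: _)^T]linearZ /= mulmxBl mulmxDr.
rewrite -!scalemxAl -!scalemxAr !linearD linearN !linearZ /= => e.
have {}e : b * (\tr (x *m x^T) + \tr (y *m y^T)) = 0.
  by move: e; rewrite -[_ *: - _]/(b * - _) => e; lra.
have [xy0|xy_neq0] := eqVneq (\tr (x *m x^T) + \tr (y *m y^T)) 0.
  have x_ge0 := mxtrace_mulmx_tr_ge0 x; have y_ge0 := mxtrace_mulmx_tr_ge0 y.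
  have x0 : x = 0 by apply: mxtrace_mulmx_tr_eq0; lra.
  have y0 : y = 0 by apply: mxtrace_mulmx_tr_eq0; lra.
  case/eqP: v0; apply/rowP => j.
  have := congr1 (fun M : 'rV_m.+1 => M 0 j) x0.
  have := congr1 (fun M : 'rV_m.+1 => M 0 j) y0.
  by rewrite !mxE; case: (v 0 j) => ? ? /= -> ->.
have b0 : b = 0.
  by move/eqP: e; rewrite mulf_eq0 (negbTE xy_neq0) orbF => /eqP.
exists a; have [x0|x_neq0] := eqVneq x 0; last first.
  by exists x; rewrite xS b0 scale0r subr0.
exists y; rewrite yS b0 scale0r add0r; split=> //.
by apply: contraNneq xy_neq0 => ->; rewrite x0 !mul0mx mxtrace0 addr0.
Qed.

Lemma mulmx_tr11 (R : realType) (m : nat) (x y : 'rV[R]_m) :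
  x *m y^T = (\tr (x *m y^T))%:M.
Proof. by rewrite trace_mx11 -mx11_scalar. Qed.

(** [H] is the reflection along [w = x - e], which exchanges the unit vectors [e] and [x]; when
    [w = 0] the identity serves. *)
Lemma householder (R : realType) (m : nat) (x : 'rV[R]_m.+1) :
  \tr (x *m x^T) = 1 ->
  exists H : 'M[R]_m.+1, [/\ H *m H^T = 1%:M, H^T = H & row 0 H = x].
Proof.
move=> x1; pose e := delta_mx 0 0 : 'rV[R]_m.+1.
have [w wE] : exists w, w = x - e by exists (x - e).
have ee : \tr (e *m e^T) = 1.
  by rewrite trmx_delta mul_delta_mx trace_mx11 mxE !eqxx.
have [w0|w_neq0] := eqVneq (\tr (w *m w^T)) 0.
  exists 1%:M; rewrite trmx1 mulmx1; split=> //.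
  by move/mxtrace_mulmx_tr_eq0/eqP: w0; rewrite wE subr_eq0 row1 => /eqP.
pose c := 2 / \tr (w *m w^T); pose H := 1%:M - c *: (w^T *m w).
have HT : H^T = H by rewrite /H linearB linearZ /= trmx1 trmx_mul trmxK.
exists H; split=> //.
  have ww : w^T *m w *m (w^T *m w) = \tr (w *m w^T) *: (w^T *m w).
    by rewrite mulmxA -(mulmxA w^T) [X in w^T *m X]mulmx_tr11 mul_mx_scalar -scalemxAl.
  rewrite HT /H mulmxBl mul1mx mulmxBr mulmx1 -!scalemxAl -!scalemxAr ww.
  rewrite !scalerA (_ : c * c * _ = c + c); last by rewrite /c; field.
  by rewrite scalerDl opprB addrK subrK.
rewrite rowE /H mulmxBr mulmx1 -/e -scalemxAr mulmxA mulmx_tr11 mul_scalar_mx.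
have xe : \tr (e *m x^T) = \tr (x *m e^T).
  by rewrite -mxtrace_tr trmx_mul trmxK.
have cE : c * \tr (e *m w^T) = -1.
  move: w_neq0; rewrite /c wE linearB /= mulmxBl !mulmxBr !linearB /=.
  rewrite x1 ee xe; move: (\tr _) => t h.
  by field; apply: contraNneq h => h; apply/eqP; lra.
by rewrite scalerA cE scaleN1r opprK wE addrC subrK.
Qed.

(** Deflation: conjugating by a reflection whose first row is a unit eigenvector gives a symmetric
    matrix with first row a multiple of the first basis vector, hence block diagonal, and the
    induction acts on the lower block. *)
Theorem symmetric_spectral (R : realType) (m : nat) (S : 'M[R]_m) :
  S^T = S ->
  exists (V : 'M[R]_m) (d : 'rV[R]_m), V *m V^T = 1%:M /\ V *m S *m V^T = diag_mx d.
Proof.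
elim: m S => [|m IH] S Ssym.
  exists 1%:M, 0; split; apply/matrixP; by move=> [].
have [a [x [x_neq0 xS]]] := symmetric_eigenvector Ssym.
have [y [y1 yS]] : exists y : 'rV[R]_m.+1, \tr (y *m y^T) = 1 /\ y *m S = a *: y.
  have xx : 0 < \tr (x *m x^T).
    rewrite lt_neqAle mxtrace_mulmx_tr_ge0 andbT eq_sym.
    by apply: contraNneq x_neq0 => /mxtrace_mulmx_tr_eq0 ->.
  exists ((Num.sqrt (\tr (x *m x^T)))^-1 *: x); split; last first.
    by rewrite -scalemxAl xS !scalerA mulrC.
  rewrite linearZ /= -scalemxAl -scalemxAr !linearZ /= mulrA -expr2 exprVn.
  by rewrite sqr_sqrtr ?mulVf ?ltW // gt_eqF.
have [H [HH HT Hy]] := householder y1.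
pose T : 'M[R]_(1 + m) := H *m S *m H^T.
have TT : T^T = T by rewrite /T !trmx_mul trmxK Ssym mulmxA.
have T0 : row 0 T = a *: delta_mx 0 0.
  rewrite /T !rowE mulmxA mulmxA -rowE Hy yS -scalemxAl -Hy HT -row_mul -{2}HT HH.
  by rewrite row1.
have TE : H *m S *m H^T = T by [].
clearbody T.
have Tul : ulsubmx T = a%:M.
  apply/matrixP => i j; rewrite !mxE !ord1.
  have := congr1 (fun M : 'rV_m.+1 => M 0 0) T0; rewrite !mxE !eqxx mulr1 mulr1n => <-.
  by congr (T _ _); apply: val_inj.
have Tur : ursubmx T = 0.
  apply/matrixP => i j; rewrite !mxE ord1.
  have := congr1 (fun M : 'rV_m.+1 => M 0 (rshift 1 j)) T0; rewrite !mxE /=.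
  rewrite mulr0 => <-.
  by congr (T _ _); apply: val_inj.
have Tdl : dlsubmx T = 0 by rewrite -[T]TT -trmx_ursub Tur trmx0.
have [V [d [VV Vd]]] := IH (drsubmx T) ltac:(by rewrite trmx_drsub TT).
pose G : 'M[R]_(1 + m) := block_mx 1%:M 0 0 V.
have GT : G^T = block_mx 1%:M 0 0 V^T by rewrite tr_block_mx !trmx0 trmx1.
have GG : G *m G^T = 1%:M.
  rewrite GT mulmx_block.
  by rewrite !mulmx0 !mul0mx !addr0 !add0r mulmx1 VV -scalar_mx_block.
have GTG : G *m T *m G^T = diag_mx (row_mx a%:M d).
  rewrite GT -[T]submxK Tul Tur Tdl !mulmx_block.
  rewrite !(mulmx0, mul0mx, mulmx1, mul1mx, addr0, add0r) Vd.
  rewrite diag_mx_row; congr (block_mx _ _ _ _).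
  by apply/matrixP => i j; rewrite !mxE !ord1.
exists (G *m H), (row_mx a%:M d); rewrite trmx_mul; split.
  by rewrite mulmxA -(mulmxA _ H) HH mulmx1.
by rewrite -GTG -TE !mulmxA.
Qed.

(** * Singular value decomposition *)

Lemma mup_prod_XsubC (R : realType) (s : seq R) x :
  mup x (\prod_(y <- s) ('X - y%:P)) = count_mem x s.
Proof.
elim: s => [|y s IH].
  by rewrite big_nil mupNroot // root1.
rewrite big_cons mupM ?polyXsubC_eq0 //; last first.
  by rewrite monic_neq0 // monic_prod_XsubC.
by rewrite IH -['X - _]expr1 mup_XsubCX /= [y == x]eq_sym; case: eqP.
Qed.

Lemma count_mem_flatten_nseq (T : eqType) (f : T -> nat) (r : seq T) x :
  uniq r ->
  count_mem x (flatten [seq nseq (f y) y | y <- r]) = ((x \in r) * f x)%N.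
Proof.
elim: r => [|y r IH] //= /andP[yr /IH {}IH].
rewrite count_cat IH count_nseq inE /= [y == x]eq_sym.
have [->|] := eqVneq x y; last by [].
by rewrite (negbTE yr) addn0.
Qed.

(** Bridge from the definition of [singular_values] to a diagonalization: the root list of a split
    polynomial is complete, multiplicities included. *)
Lemma perm_roots_with_mult (R : realType) (s : seq R) :
  perm_eq (roots_with_mult (\prod_(x <- s) ('X - x%:P))) s.
Proof.
set p := \prod_(x <- s) _.
have p0 : p != 0 by rewrite monic_neq0 // monic_prod_XsubC.
apply/allP => x _ /=; rewrite count_mem_flatten_nseq; last first.
  exact: polyrcf.uniq_roots.
rewrite mup_prod_XsubC; apply/eqP.
have := polyrcf.roots_on_rootsR p0 x; rewrite !inE /= root_prod_XsubC => <-.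
by rewrite -has_pred1 has_count; case: (count_mem x s) => //= k; rewrite mul1n.
Qed.

Lemma char_poly_orthogonal_conj (R : realType) m (S V : 'M[R]_m) :
  V *m V^T = 1%:M -> char_poly (V *m S *m V^T) = char_poly S.
Proof.
move=> VV; pose W := map_mx (polyC : {rmorphism R -> {poly R}}) V.
have WW : W *m W^T = 1%:M by rewrite /W map_trmx -map_mxM VV map_scalar_mx.
rewrite /char_poly; suff -> : char_poly_mx (V *m S *m V^T) =
    W *m char_poly_mx S *m W^T.
  by rewrite !det_mulmx mulrAC -det_mulmx WW det1 mul1r.
rewrite /char_poly_mx mulmxBr mulmxBl mul_mx_scalar -scalemxAl WW.
by rewrite scalemx1 !map_mxM map_trmx.
Qed.

Section SingularValues.
Variables (R : realType) (n m : nat).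
Implicit Types X : 'M[R]_(n, m).

Lemma singular_values_perm X :
  exists (V : 'M[R]_m) (d : 'rV[R]_m),
    [/\ V *m V^T = 1%:M, V *m (X^T *m X) *m V^T = diag_mx d,
        forall j, 0 <= d 0 j &
        perm_eq (singular_values X) [tuple Num.sqrt (d 0 j) | j < m]].
Proof.
have [|V [d [VV Vd]]] := @symmetric_spectral _ _ (X^T *m X).
  by rewrite trmx_mul trmxK.
exists V, d; split=> //.
  move=> j; have -> : d 0 j = diag_mx d j j by rewrite mxE eqxx mulr1n.
  have -> : diag_mx d = (X *m V^T)^T *m (X *m V^T).
    by rewrite -Vd trmx_mul trmxK !mulmxA.
  by rewrite mxE; apply: sumr_ge0 => i _; rewrite mxE -expr2 sqr_ge0.
rewrite perm_sort /=.
have -> : char_poly (X^T *m X) =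
    \prod_(x <- [tuple d 0 j | j < m]) ('X - x%:P).
  rewrite -(char_poly_orthogonal_conj _ VV) Vd char_poly_trig; last first.
    exact/is_diag_mx_is_trig/diag_mx_is_diag.
  rewrite /= big_map -big_enum /=; apply: eq_bigr => j _.
  by rewrite mxE eqxx mulr1n.
have /(perm_map Num.sqrt) := perm_roots_with_mult [tuple d 0 j | j < m].
by rewrite /= -map_comp.
Qed.

Lemma size_singular_values X : size (singular_values X) = m.
Proof.
have [V [d [_ _ _ /perm_size ->]]] := singular_values_perm X.
by rewrite size_tuple.
Qed.

Lemma sigma_ge0 k X : 0 <= sigma k X.
Proof.
rewrite /sigma; have [h|h] := ltnP k.-1 (size (singular_values X)); last first.
  by rewrite nth_default.
have [V [d [_ _ _ /perm_mem p]]] := singular_values_perm X.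
have := mem_nth 0 h; rewrite p => /mapP[j _ ->].
exact: sqrtr_ge0.
Qed.

(** The ends of the range are harmless: index 0 reads the same entry as index 1, and past the end
    the default 0 lies below every singular value. *)
Lemma sigma_anti j k X : (j <= k)%N -> sigma k X <= sigma j X.
Proof.
move=> jk; rewrite {1}/sigma.
have [h|h] := ltnP k.-1 (size (singular_values X)); last first.
  by rewrite nth_default ?sigma_ge0.
have : sorted (fun a b : R => b <= a) (singular_values X).
  by apply: sort_sorted => a b; exact: ge_total.
have trans : transitive (fun a b : R => b <= a)
  by move=> a b c ba /le_trans; apply.
move=> /(sorted_leq_nth trans (fun x : R => lexx x) 0) => s.
by apply: s; rewrite ?inE //; lia.
Qed.

Lemma nuclear_normE X : nuclear_norm X = \sum_(j < m) sigma j.+1 X.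
Proof.
by rewrite /nuclear_norm (big_nth 0) big_mkord size_singular_values.
Qed.

(* [U] is only a partial isometry: its columns at the zero singular values
   vanish, since [X] need not have enough left singular vectors. *)
Lemma svd X : exists (U : 'M[R]_(n, m)) (V : 'M[R]_m),
  [/\ V^T *m V = 1%:M,
      X *m V = U *m diag_mx (\row_j sigma j.+1 X) &
      U^T *m U = diag_mx (\row_j (sigma j.+1 X != 0)%:R)].
Proof.
have [V [d [VV Vd d_ge0 /tuple_permP[p sp]]]] := singular_values_perm X.
have sE (j : 'I_m) : sigma j.+1 X = Num.sqrt (d 0 (p j)).
  rewrite /sigma sp /= (nth_map j) ?size_enum_ord //.
  by rewrite nth_ord_enum tnth_map tnth_ord_tuple.
pose W := (row_perm p V)^T.
have WE (A : 'M[R]_m) i j : (W^T *m A *m W) i j = (V *m A *m V^T) (p i) (p j).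
  rewrite !mxE; apply: eq_bigr => k _; rewrite !mxE; congr (_ * _).
  by apply: eq_bigr => l _; rewrite !mxE.
have WW : W^T *m W = 1%:M.
  apply/matrixP => i j; have := WE 1%:M i j.
  by rewrite !mulmx1 VV !mxE (inj_eq perm_inj).
have XW : (X *m W)^T *m (X *m W) = diag_mx (\row_j sigma j.+1 X ^+ 2).
  apply/matrixP => i j; rewrite trmx_mul mulmxA -(mulmxA _ X^T X) WE Vd.
  by rewrite !mxE (inj_eq perm_inj) sE sqr_sqrtr.
exists (X *m W *m diag_mx (\row_j (sigma j.+1 X)^-1)), W; split=> //.
  rewrite -mulmxA mulmx_diag; apply/matrixP => i j; rewrite mul_mx_diag.
  rewrite [RHS]mxE !mxE.
  have [s0|s0] := eqVneq (sigma j.+1 X) 0; last first.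
    by rewrite mulVf // mulr1.
  have := congr1 (fun A : 'M[R]_m => A j j) XW.
  rewrite !mxE eqxx mulr1n s0 expr0n /= mulr0 => /eqP.
  rewrite psumr_eq0 => [/allP /(_ i (mem_index_enum _))|k _]; last first.
    by rewrite !mxE -expr2 sqr_ge0.
  by rewrite !mxE -expr2 sqrf_eq0 mulr0 => /eqP.
move: (X *m W) XW => M MM.
rewrite trmx_mul tr_diag_mx -mulmxA [M^T *m _]mulmxA MM.
rewrite !mulmx_diag; congr diag_mx; apply/rowP => j; rewrite !mxE.
have [->|s0] := eqVneq (sigma j.+1 X) 0; first by rewrite invr0 mul0r.
by rewrite expr2 mulfK // mulVf.
Qed.

End SingularValues.

(** * Frobenius inner product *)

Section Inner.
Variable R : realType.

Lemma innerE n m (X Y : 'M[R]_(n, m)) : inner X Y = \sum_i \sum_j X i j * Y i j.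
Proof.
rewrite exchange_big; apply: eq_bigr => j _; rewrite mxE.
by apply: eq_bigr => i _; rewrite mxE.
Qed.

Lemma innerC n m (X Y : 'M[R]_(n, m)) : inner X Y = inner Y X.
Proof. by rewrite /inner -mxtrace_tr trmx_mul trmxK. Qed.

Lemma innerDr n m (X Y Z : 'M[R]_(n, m)) : inner X (Y + Z) = inner X Y + inner X Z.
Proof. by rewrite /inner mulmxDr mxtraceD. Qed.

Lemma innerNr n m (X Y : 'M[R]_(n, m)) : inner X (- Y) = - inner X Y.
Proof. by rewrite /inner mulmxN linearN. Qed.

Lemma innerZr n m a (X Y : 'M[R]_(n, m)) : inner X (a *: Y) = a * inner X Y.
Proof. by rewrite /inner -scalemxAr linearZ. Qed.

Lemma inner0r n m (X : 'M[R]_(n, m)) : inner X 0 = 0.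
Proof. by rewrite /inner mulmx0 mxtrace0. Qed.

Lemma innerDl n m (X Y Z : 'M[R]_(n, m)) : inner (Y + Z) X = inner Y X + inner Z X.
Proof. by rewrite !(innerC _ X) innerDr. Qed.

Lemma innerNl n m (X Y : 'M[R]_(n, m)) : inner (- Y) X = - inner Y X.
Proof. by rewrite !(innerC _ X) innerNr. Qed.

Lemma innerZl n m a (X Y : 'M[R]_(n, m)) : inner (a *: Y) X = a * inner Y X.
Proof. by rewrite !(innerC _ X) innerZr. Qed.

Lemma inner0l n m (X : 'M[R]_(n, m)) : inner 0 X = 0.
Proof. by rewrite innerC inner0r. Qed.

Definition inner_linear := (innerDl, innerDr, innerNl, innerNr, innerZl, innerZr).

Lemma inner_tr n m (X Y : 'M[R]_(n, m)) : inner X^T Y^T = inner X Y.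
Proof. by rewrite innerC /inner trmxK mxtrace_mulC. Qed.

Lemma inner_mulmxl n m p (A : 'M[R]_(n, m)) (X : 'M[R]_(m, p)) Y :
  inner (A *m X) Y = inner X (A^T *m Y).
Proof. by rewrite /inner trmx_mul mulmxA. Qed.

Lemma inner_mulmxr n m p (A : 'M[R]_(m, p)) (X : 'M[R]_(n, m)) Y :
  inner (X *m A) Y = inner X (Y *m A^T).
Proof. by rewrite -inner_tr trmx_mul inner_mulmxl -trmx_mul inner_tr. Qed.

Lemma inner_ge0 n m (X : 'M[R]_(n, m)) : 0 <= inner X X.
Proof. by rewrite innerE; do 2 apply: sumr_ge0 => ? _; rewrite -expr2 sqr_ge0. Qed.

Lemma inner_eq0 n m (X : 'M[R]_(n, m)) : (inner X X == 0) = (X == 0).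
Proof.
apply/eqP/eqP => [h|->]; last by rewrite inner0l.
apply: mxtrace_mulmx_tr_eq0.
by rewrite mxtrace_mulC -/(inner X X).
Qed.

Lemma inner_CS n m (X Y : 'M[R]_(n, m)) :
  inner X Y ^+ 2 <= inner X X * inner Y Y.
Proof.
have [Y0|Y0] := eqVneq (inner Y Y) 0.
  by move/eqP: Y0; rewrite inner_eq0 => /eqP ->; rewrite !inner0r expr0n mulr0.
have y_gt0 : 0 < inner Y Y by rewrite lt_neqAle eq_sym Y0 inner_ge0.
have := inner_ge0 (inner Y Y *: X - inner X Y *: Y).
rewrite !inner_linear (innerC Y X) => h; rewrite -subr_ge0 -(pmulr_rge0 _ y_gt0).
by apply: le_trans h _; rewrite le_eqVlt; apply/orP; left; apply/eqP; ring.
Qed.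

Lemma frobenius_norm_ge0 n m (X : 'M[R]_(n, m)) : 0 <= frobenius_norm X.
Proof. exact: sqrtr_ge0. Qed.

Lemma frobenius_sq n m (X : 'M[R]_(n, m)) : frobenius_norm X ^+ 2 = inner X X.
Proof. by rewrite sqr_sqrtr // inner_ge0. Qed.

Lemma frobenius_norm0 n m : frobenius_norm (0 : 'M[R]_(n, m)) = 0.
Proof. by rewrite /frobenius_norm inner0l sqrtr0. Qed.

Lemma frobenius_norm_eq0 n m (X : 'M[R]_(n, m)) : (frobenius_norm X == 0) = (X == 0).
Proof. by rewrite -inner_eq0 -frobenius_sq sqrf_eq0. Qed.

Lemma frobenius_normN n m (X : 'M[R]_(n, m)) : frobenius_norm (- X) = frobenius_norm X.
Proof. by rewrite /frobenius_norm !inner_linear opprK. Qed.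

Lemma frobenius_normZ n m a (X : 'M[R]_(n, m)) :
  frobenius_norm (a *: X) = `|a| * frobenius_norm X.
Proof.
by rewrite /frobenius_norm !inner_linear mulrA -expr2 sqrtrM ?sqr_ge0 // sqrtr_sqr.
Qed.

Lemma inner_le_norm n m (X Y : 'M[R]_(n, m)) :
  inner X Y <= frobenius_norm X * frobenius_norm Y.
Proof.
apply: le_trans (ler_norm _) _; rewrite -ler_sqr ?nnegrE ?mulr_ge0 ?sqrtr_ge0 //.
by rewrite exprMn !frobenius_sq real_normK ?num_real // inner_CS.
Qed.

Lemma frobenius_triangle n m (X Y : 'M[R]_(n, m)) :
  frobenius_norm (X + Y) <= frobenius_norm X + frobenius_norm Y.
Proof.
rewrite -ler_sqr ?nnegrE ?addr_ge0 ?sqrtr_ge0 // sqrrD !frobenius_sq !inner_linear.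
by have := inner_le_norm X Y; rewrite (innerC Y X); lra.
Qed.

Lemma inner_isometry n m p (B : 'M[R]_(n, m)) (X Y : 'M[R]_(m, p)) :
  B^T *m B = 1%:M -> inner (B *m X) (B *m Y) = inner X Y.
Proof. by move=> BB; rewrite inner_mulmxl mulmxA BB mul1mx. Qed.

Lemma inner_isometry_dim n m (B : 'M[R]_(n, m)) :
  B^T *m B = 1%:M -> inner B B = m%:R.
Proof. by rewrite /inner => ->; rewrite mxtrace1. Qed.

Lemma inner_proj_compl n m p (B : 'M[R]_(n, m)) (A : 'M[R]_(n, p)) :
  B^T *m B = 1%:M ->
  inner (A - B *m (B^T *m A)) (A - B *m (B^T *m A)) =
    inner A A - inner (B^T *m A) (B^T *m A).
Proof.
move=> BB; rewrite !inner_linear inner_isometry // (innerC A) inner_mulmxl; ring.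
Qed.

Lemma inner_proj_complr n m p (B : 'M[R]_(n, m)) (A : 'M[R]_(p, n)) :
  B^T *m B = 1%:M ->
  inner (A - A *m B *m B^T) (A - A *m B *m B^T) =
    inner A A - inner (A *m B) (A *m B).
Proof.
move=> BB; rewrite -inner_tr !linearB /= !trmx_mul trmxK.
by rewrite inner_proj_compl // -trmx_mul !inner_tr.
Qed.

Lemma inner_rank1 n m (u : 'cV[R]_n) (v : 'cV_m) (Z : 'M[R]_(n, m)) :
  inner (u *m v^T) Z = inner u (Z *m v).
Proof. by rewrite inner_mulmxr trmxK. Qed.

Lemma mul_tr_inner n (u v : 'cV[R]_n) : u^T *m v = (inner u v)%:M.
Proof. by rewrite /inner trace_mx11 -mx11_scalar. Qed.

Lemma inner_rank1_rank1 n m (u w : 'cV[R]_n) (v z : 'cV_m) :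
  inner (u *m v^T) (w *m z^T) = inner u w * inner v z.
Proof.
by rewrite inner_rank1 -mulmxA mul_tr_inner mul_mx_scalar innerZr mulrC (innerC z).
Qed.

End Inner.

(** * Singular values, rank and norms *)

Section SVDConsequences.
Variables (R : realType) (n m : nat).
Implicit Types X Y Z : 'M[R]_(n, m).

Let D X : 'M[R]_m := diag_mx (\row_j sigma j.+1 X).

Lemma pid_mx_diag k : pid_mx k = diag_mx (\row_j (j < k)%:R) :> 'M[R]_m.
Proof.
apply/matrixP => i j; rewrite !mxE -val_eqE.
by case: eqP => //= _; case: ltnP.
Qed.

(** In the basis of right singular vectors [|X M|^2] is a sum weighted by the squared singular
    values. This formula yields both the upper bound by the spectral norm and the lower bound on a
    frame. *)
Lemma inner_mulmx_svdE X U V :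
  V^T *m V = 1%:M -> X *m V = U *m diag_mx (\row_j sigma j.+1 X) ->
  U^T *m U = diag_mx (\row_j (sigma j.+1 X != 0)%:R) ->
  forall p (M : 'M[R]_(m, p)), inner (X *m M) (X *m M) =
    \sum_(j < m) sigma j.+1 X ^+ 2 * \sum_k (V^T *m M) j k ^+ 2.
Proof.
move=> VV XV UU p M; have VVT := mulmx1C VV.
have -> : X *m M = U *m D X *m (V^T *m M).
  by rewrite -[U *m _]XV mulmxA -(mulmxA X) VVT mulmx1.
rewrite inner_mulmxl trmx_mul tr_diag_mx !mulmxA -(mulmxA _ U^T) UU !mulmx_diag.
rewrite -mulmxA mul_diag_mx innerE; apply: eq_bigr => j _.
rewrite mulr_sumr; apply: eq_bigr => k _.
rewrite [X in _ * X]mxE [X in _ * (X * _)]mxE !mxE.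
by have [->|s0] := eqVneq (sigma j.+1 X) 0; rewrite ?mulr1; ring.
Qed.

Lemma inner_mulmx_svd X : exists V : 'M[R]_m, [/\ V^T *m V = 1%:M, V *m V^T = 1%:M &
  forall p (M : 'M[R]_(m, p)), inner (X *m M) (X *m M) =
    \sum_(j < m) sigma j.+1 X ^+ 2 * \sum_k (V^T *m M) j k ^+ 2].
Proof.
have [U [V [VV XV UU]]] := svd X; exists V; split=> //; first exact: mulmx1C.
exact: inner_mulmx_svdE VV XV UU.
Qed.

Lemma inner_sum_sigma X : inner X X = \sum_(j < m) sigma j.+1 X ^+ 2.
Proof.
have [V [VV VVT /(_ _ V)]] := inner_mulmx_svd X.
rewrite inner_mulmxr -mulmxA VVT mulmx1 VV => ->.
apply: eq_bigr => j _; rewrite (bigD1 j) //= mxE eqxx expr1n big1 ?addr0 ?mulr1 //.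
by move=> k kj; rewrite mxE eq_sym (negbTE kj) expr0n.
Qed.

Lemma inner_rows p (M : 'M[R]_(m, p)) : inner M M = \sum_j \sum_k M j k ^+ 2.
Proof. by rewrite innerE; do 2 apply: eq_bigr => ? _; rewrite expr2. Qed.

Lemma spectral_norm_mulmx X p (M : 'M[R]_(m, p)) :
  inner (X *m M) (X *m M) <= spectral_norm X ^+ 2 * inner M M.
Proof.
have [V [VV VVT ->]] := inner_mulmx_svd X.
have <- : inner (V^T *m M) (V^T *m M) = inner M M.
  by rewrite inner_isometry // trmxK.
rewrite inner_rows mulr_sumr; apply: ler_sum => j _.
apply: ler_wpM2r; first by apply: sumr_ge0 => ? _; exact: sqr_ge0.
by rewrite ler_sqr ?nnegrE ?sigma_ge0 // sigma_anti.
Qed.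

Lemma spectral_norm_le_frobenius X : spectral_norm X <= frobenius_norm X.
Proof.
rewrite -ler_sqr ?nnegrE ?sigma_ge0 ?frobenius_norm_ge0 // frobenius_sq.
rewrite inner_sum_sigma; have [m0|m0] := posnP m.
  rewrite /spectral_norm /sigma nth_default ?size_singular_values ?m0 // expr0n.
  by apply: sumr_ge0 => ? _; exact: sqr_ge0.
rewrite (bigD1 (Ordinal m0)) //= lerDl.
by apply: sumr_ge0 => ? _; exact: sqr_ge0.
Qed.

Lemma frobenius_norm_mulmx X p (M : 'M[R]_(m, p)) :
  frobenius_norm (X *m M) <= frobenius_norm X * frobenius_norm M.
Proof.
rewrite -ler_sqr ?nnegrE ?mulr_ge0 ?frobenius_norm_ge0 // exprMn !frobenius_sq.
apply: le_trans (spectral_norm_mulmx _ _) _; apply: ler_wpM2r; first exact: inner_ge0.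
rewrite -frobenius_sq ler_sqr ?nnegrE ?sigma_ge0 ?frobenius_norm_ge0 //.
exact: spectral_norm_le_frobenius.
Qed.

(** If [sigma k X] were nonzero, the first [k] singular values could be inverted, which would factor
    a partial identity of rank [k] through [X]. *)
Lemma sigma_gt_rank X k : (\rank X < k)%N -> sigma k X = 0.
Proof.
case: k => // k Xk; have [km|km] := ltnP k m; last first.
  by rewrite /sigma nth_default // size_singular_values.
apply: contraTeq Xk => s0; rewrite -leqNgt.
have [U [V [VV XV UU]]] := svd X.
have e : pid_mx k.+1 = diag_mx (\row_j (if (j < k.+1)%N then (sigma j.+1 X)^-1 else 0))
    *m U^T *m (X *m V) :> 'M[R]_m.
  rewrite XV mulmxA -(mulmxA _ U^T) UU !mulmx_diag pid_mx_diag.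
  congr diag_mx; apply/rowP => i; rewrite !mxE.
  have [ik|ik] := ltnP i k.+1; last by rewrite !mul0r.
  have si : sigma i.+1 X != 0.
    have s_gt0 : 0 < sigma k.+1 X by rewrite lt_neqAle eq_sym s0 sigma_ge0.
    by rewrite gt_eqF // (lt_le_trans s_gt0) // sigma_anti.
  by rewrite si mulr1 mulVf.
have <- : \rank (pid_mx k.+1 : 'M[R]_m) = k.+1 by rewrite rank_pid_mx.
rewrite e; apply: leq_trans (mxrankM_maxr _ _) _; exact: mxrankM_maxl.
Qed.

(** At a zero singular value [u] is the zero vector, whence the indicator in [inner u u]. The last
    clause removes the final singular triple and drives the exchange arguments. *)
Lemma singular_pair X k : (k < m)%N -> exists (u : 'cV[R]_n) (v : 'cV[R]_m),
  [/\ inner v v = 1, inner u u = (sigma k.+1 X != 0)%:R,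
      X *m v = sigma k.+1 X *: u, X^T *m u = sigma k.+1 X *: v &
      (\rank X <= k.+1)%N ->
      (\rank (X - sigma k.+1 X *: (u *m v^T))%R <= k)%N].
Proof.
move=> km; have [U [V [VV XV UU]]] := svd X; have VVT := mulmx1C VV.
pose i := Ordinal km; pose e : 'cV[R]_m := delta_mx i 0.
have ee : e^T *m e = 1%:M.
  by rewrite trmx_delta mul_delta_mx; apply/matrixP => a b; rewrite !mxE !ord1.
have De (d : 'rV[R]_m) : diag_mx d *m e = d 0 i *: e.
  apply/matrixP => a b; rewrite mul_diag_mx !mxE !ord1 eqxx andbT.
  by case: eqP => [->|]; rewrite ?mulr0.
have XE : X = U *m D X *m V^T by rewrite -[U *m _]XV -mulmxA VVT mulmx1.
exists (U *m e), (V *m e); split.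
- by rewrite inner_isometry // /inner ee mxtrace1.
- by rewrite inner_mulmxl mulmxA UU De innerZr /inner ee mxtrace1 mxE mulr1.
- by rewrite mulmxA XV -mulmxA De mxE scalemxAr.
- have -> : X^T = V *m D X *m U^T by rewrite {1}XE !trmx_mul trmxK tr_diag_mx mulmxA.
  rewrite -!mulmxA (mulmxA U^T) UU De -!scalemxAr De.
  rewrite !mxE -scalemxAr scalerA -/i /=.
  by have [->|] := eqVneq (sigma k.+1 X) 0; rewrite ?mul1r ?mulr0.
move=> Xk.
have -> : X - sigma k.+1 X *: (U *m e *m (V *m e)^T) = U *m D X *m pid_mx k *m V^T.
  transitivity (U *m D X *m V^T - sigma k.+1 X *: (U *m (e *m e^T) *m V^T)).
    by rewrite -XE trmx_mul !mulmxA.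
  rewrite scalemxAl scalemxAr -mulmxBl -mulmxBr -(mulmxA U (D X)).
  congr (_ *m _ *m _).
  rewrite trmx_delta mul_delta_mx pid_mx_diag mulmx_diag.
  apply/matrixP => a b; rewrite !mxE.
  have [<-{b}|ab] := eqVneq a b; last first.
    rewrite !mulr0n; case: eqP => [ai|_] /=; last by rewrite mulr0 subr0.
    by rewrite -ai eq_sym (negbTE ab) mulr0 subr0.
  rewrite andbb !mulr1n; have [->|ai] := eqVneq a i.
    by rewrite /= ltnn mulr0 mulr1 subrr.
  rewrite mulr0 subr0; have [ak|ka] := ltnP a k; first by rewrite mulr1.
  rewrite mulr0 sigma_gt_rank //; apply: leq_ltn_trans Xk _.
  by rewrite ltnS ltn_neqAle ka andbT eq_sym.
rewrite -mulmxA; apply: leq_trans (mxrankM_maxr _ _) _.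
apply: leq_trans (mxrankM_maxl _ _) _.
by rewrite rank_pid_mx // ltnW.
Qed.

(** [B] collects the first [k] right singular vectors. By the rank bound they carry all of [X], and
    on their span [X] stretches by at least its [k]-th singular value. *)
Lemma rank_le_row_isometry X k : (k <= m)%N -> (\rank X <= k)%N ->
  exists B : 'M[R]_(m, k), [/\ B^T *m B = 1%:M, X *m B *m B^T = X &
    forall p (M : 'M[R]_(m, p)), sigma k X ^+ 2 * inner (B^T *m M) (B^T *m M)
      <= inner (X *m M) (X *m M)].
Proof.
move=> km Xk.
have [U [V [VV XV UU]]] := svd X; have VVT := mulmx1C VV.
have XE : X = U *m D X *m V^T by rewrite -[U *m _]XV -mulmxA VVT mulmx1.
exists (V *m pid_mx k); split.
- rewrite trmx_mul tr_pid_mx mulmxA -(mulmxA _ V^T) VV mulmx1.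
  by rewrite pid_mx_id // pid_mx_1.
- rewrite trmx_mul tr_pid_mx !mulmxA XV -!mulmxA (mulmxA (pid_mx k)) pid_mx_id //.
  rewrite pid_mx_diag (mulmxA (diag_mx _)) mulmx_diag [RHS]XE -!mulmxA.
  congr (_ *m (diag_mx _ *m _)); apply/rowP => j; rewrite !mxE.
  have [jk|jk] := ltnP j k; first by rewrite mulr1.
  by rewrite mulr0 sigma_gt_rank //; lia.
move=> p M; rewrite trmx_mul -mulmxA tr_pid_mx inner_mulmxl tr_pid_mx.
rewrite (mulmxA (pid_mx k)) pid_mx_id // pid_mx_diag mul_diag_mx innerE mulr_sumr.
rewrite (inner_mulmx_svdE VV XV UU).
apply: ler_sum => j _; rewrite mulr_sumr mulr_sumr; apply: ler_sum => c _.
rewrite [X in _ * (_ * X)]mxE [X in _ * (_ * (X * _))]mxE.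
have [jk|jk] := ltnP j k; last first.
  by rewrite mul0r !mulr0 mulr_ge0 ?sqr_ge0.
rewrite mul1r -expr2; apply: ler_wpM2r; first exact: sqr_ge0.
by rewrite ler_sqr ?nnegrE ?sigma_ge0 // sigma_anti.
Qed.

End SVDConsequences.

(** * Duality of the nuclear and spectral norms *)

Section Duality.
Variables (R : realType) (n m : nat).
Implicit Types X Y Z W : 'M[R]_(n, m).

Lemma inner_cols p q (A B : 'M[R]_(p, q)) :
  inner A B = \sum_j inner (col j A) (col j B).
Proof.
rewrite innerE exchange_big; apply: eq_bigr => j _; rewrite innerE.
by apply: eq_bigr => i _; rewrite big_ord1 !mxE.
Qed.

Lemma frobenius_norm_le p q (A : 'M[R]_(p, q)) a :
  0 <= a -> inner A A <= a ^+ 2 -> frobenius_norm A <= a.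
Proof.
by move=> a0 Aa; rewrite -ler_sqr ?nnegrE ?frobenius_norm_ge0 // frobenius_sq.
Qed.

(** In the basis [V] the pairing is the sum of [sigma j.+1 X] times [<u_j, Z v_j>], and each of
    these products is at most the spectral norm of [Z] because [|u_j| <= 1 = |v_j|]. *)
Lemma inner_le_nuclear_spectral X Z :
  inner X Z <= nuclear_norm X * spectral_norm Z.
Proof.
have [U [V [VV XV UU]]] := svd X; have VVT := mulmx1C VV.
have -> : inner X Z = inner (X *m V) (Z *m V).
  by rewrite inner_mulmxr -mulmxA VVT mulmx1.
rewrite XV inner_cols nuclear_normE mulr_suml; apply: ler_sum => j _.
have -> : col j (U *m diag_mx (\row_j sigma j.+1 X)) = sigma j.+1 X *: col j U.
  by rewrite mul_mx_diag; apply/colP => i; rewrite !mxE mulrC.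
rewrite innerZl; apply: ler_wpM2l; first exact: sigma_ge0.
apply: le_trans (inner_le_norm _ _) _; rewrite -[X in _ <= X]mul1r.
have col_sq p (A : 'M[R]_(p, m)) : inner (col j A) (col j A) = (A^T *m A) j j.
  rewrite innerE mxE; apply: eq_bigr => i _.
  by rewrite big_ord1 !mxE.
apply: ler_pM; rewrite ?frobenius_norm_ge0 //; apply: frobenius_norm_le.
- by [].
- by rewrite col_sq UU !mxE eqxx mulr1n expr1n; case: eqP => //= _; exact: ler01.
- exact: sigma_ge0.
have -> : col j (Z *m V) = Z *m col j V by rewrite !colE mulmxA.
apply: le_trans (spectral_norm_mulmx _ _) _.
by rewrite col_sq VV mxE eqxx mulr1.
Qed.

(** With at most one nonzero singular value, the nuclear norm equals the Frobenius norm, which is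
    multiplicative on [u *m v^T]. *)
Lemma nuclear_norm_rank1 (u : 'cV[R]_n) (v : 'cV[R]_m) :
  nuclear_norm (u *m v^T) = frobenius_norm u * frobenius_norm v.
Proof.
have rk : (\rank (u *m v^T) <= 1)%N.
  by apply: leq_trans (mxrankM_maxl _ _) _; exact: rank_leq_col.
have s0 (j : 'I_m) : (0 < j)%N -> sigma j.+1 (u *m v^T) = 0.
  by move=> j0; rewrite sigma_gt_rank //; apply: leq_ltn_trans rk _.
have e2 : nuclear_norm (u *m v^T) ^+ 2 = (frobenius_norm u * frobenius_norm v) ^+ 2.
  rewrite exprMn !frobenius_sq -inner_rank1_rank1 inner_sum_sigma nuclear_normE.
  have [m0|m0] := posnP m.
    by rewrite !big1 ?expr0n // => -[j jm]; exfalso; move: jm; rewrite m0.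
  rewrite (bigD1 (Ordinal m0)) //= [RHS](bigD1 (Ordinal m0)) //=.
  rewrite !big1 ?addr0 // => j; rewrite -val_eqE /= -lt0n => /s0 ->.
    by rewrite expr0n.
  by [].
apply/eqP; rewrite -(@eqrXn2 _ 2) ?e2 ?mulr_ge0 ?frobenius_norm_ge0 //.
by rewrite nuclear_normE; apply: sumr_ge0 => j _; exact: sigma_ge0.
Qed.

Lemma dual_norm_nuclear Z : (0 < m)%N -> dual_norm nuclear_norm Z = spectral_norm Z.
Proof.
move=> m0; have [u [v [vv uu Zv _ _]]] := singular_pair Z m0.
have ub : ubound [set inner X Z | X in [set X | nuclear_norm X <= 1]] (spectral_norm Z).
  move=> _ [X /= X1 <-]; apply: le_trans (inner_le_nuclear_spectral _ _) _.
  by rewrite -[leRHS]mul1r; apply: ler_wpM2r => //; exact: sigma_ge0.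
have at_s : [set inner X Z | X in [set X | nuclear_norm X <= 1]] (spectral_norm Z).
  (* The supremum is attained at the rank-one matrix of the top singular pair, which is zero when
     the spectral norm of [Z] is. *)
  exists (u *m v^T) => /=.
    rewrite nuclear_norm_rank1 /frobenius_norm vv uu sqrtr1 mulr1.
    by case: eqP; rewrite ?sqrtr0 ?sqrtr1.
  rewrite inner_rank1 Zv innerZr uu -/(spectral_norm Z).
  by have [->|] := eqVneq (spectral_norm Z) 0; rewrite ?mul0r ?mulr1.
apply/le_anti/andP; split.
  by apply: ge_sup; first by exists (spectral_norm Z).
by apply: ub_le_sup; first by exists (spectral_norm Z).
Qed.

End Duality.

(** * Nearest points of bounded rank *)

Section Separation.
Variables (R : realType) (n m : nat).
Implicit Types X Y Z W : 'M[R]_(n, m).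

Lemma unit_kernel_vector p q (A : 'M[R]_(p, q)) : (\rank A < q)%N ->
  exists v : 'cV[R]_q, inner v v = 1 /\ A *m v = 0.
Proof.
move=> Aq; have k0 : kermx A^T != 0.
  by rewrite -mxrank_eq0 mxrank_ker mxrank_tr subn_eq0 -ltnNge.
pose w := (nz_row (kermx A^T))^T.
have Aw : A *m w = 0.
  by apply: trmx_inj; rewrite trmx0 trmx_mul trmxK; apply/sub_kermxP/nz_row_sub.
have w0 : w != 0.
  by rewrite -(inj_eq trmx_inj) trmxK trmx0 nz_row_eq0.
exists ((frobenius_norm w)^-1 *: w); split.
  rewrite !inner_linear mulrA -expr2 exprVn frobenius_sq mulVf //.
  by rewrite inner_eq0.
by rewrite -scalemxAr Aw scaler0.
Qed.

(** Besides orthonormality of [B], this says that [X^T *m X - s ^+ 2 *: (B *m B^T)] is positive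
    semidefinite. Letting [M] have any number of columns gives the trace form directly. *)
Definition expanding_frame X k (B : 'M[R]_(m, k)) (s : R) :=
  B^T *m B = 1%:M /\ forall p (M : 'M[R]_(m, p)),
    s ^+ 2 * inner (B^T *m M) (B^T *m M) <= inner (X *m M) (X *m M).

Lemma expanding_frame_kernel X k (B : 'M[R]_(m, k)) s p (M : 'M[R]_(m, p)) :
  expanding_frame X B s -> s != 0 -> X *m M = 0 -> B^T *m M = 0.
Proof.
move=> [_ XB] s0 XM; apply/eqP; rewrite -inner_eq0 eq_le inner_ge0 andbT.
have s2 : 0 < s ^+ 2 by rewrite lt_neqAle sqr_ge0 andbT eq_sym sqrf_eq0.
by rewrite -(pmulr_rle0 _ s2); apply: le_trans (XB _ _) _; rewrite XM inner0l.
Qed.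

Lemma row_isometry Y k : (k <= m)%N -> (\rank Y <= k)%N ->
  exists C : 'M[R]_(m, k), C^T *m C = 1%:M /\ Y *m C *m C^T = Y.
Proof. by move=> km Yk; have [C [CC YC _]] := rank_le_row_isometry km Yk; exists C. Qed.

Lemma inner_add_orth p q (A B : 'M[R]_(p, q)) :
  inner A B = 0 -> inner (A + B) (A + B) = inner A A + inner B B.
Proof. by move=> AB; rewrite !inner_linear (innerC B) AB; ring. Qed.

(* With [C] an orthonormal basis of the row space of [Y] and [Z = X + W],
   [|Y - Z|^2 >= |Z|^2 - |Z C|^2]; what [X] loses on [C] (hX) covers what [W]
   gains there (hW). *)
Lemma frame_separation X W Y k (B : 'M[R]_(m, k)) s : (k <= m)%N ->
  expanding_frame X B s -> X^T *m W = 0 -> W *m B = 0 ->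
  (forall p (M : 'M[R]_(m, p)), inner (W *m M) (W *m M) <= s ^+ 2 * inner M M) ->
  (\rank Y <= k)%N -> 2 * inner Y W <= inner (Y - X) (Y - X).
Proof.
move=> km [BB XB] XW WB Ws Yk.
have [C [CC YC]] := row_isometry km Yk.
have XWC p (M N : 'M[R]_(m, p)) : inner (X *m M) (W *m N) = 0.
  by rewrite inner_mulmxl mulmxA XW mul0mx inner0r.
have XW0 : inner X W = 0 by rewrite -[X]mulmx1 -[W]mulmx1 XWC.
(* The frame inequality is tested on the projector off the span of [C]; the defect [k - |B^T C|^2]
   measures how far the spans of [B] and [C] differ. *)
have hX : s ^+ 2 * (k%:R - inner (B^T *m C) (B^T *m C)) <= inner X X - inner (X *m C) (X *m C).
  have := XB _ (1%:M - C *m C^T).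
  rewrite !mulmxBr !mulmx1 !mulmxA !inner_proj_complr //.
  by rewrite inner_tr inner_isometry_dim.
(* Since [W] kills [B], only the part of [C] orthogonal to [B] counts, and its squared norm is the
   same defect. *)
have hW : inner (W *m C) (W *m C) <= s ^+ 2 * (k%:R - inner (B^T *m C) (B^T *m C)).
  have := Ws _ (C - B *m (B^T *m C)).
  by rewrite inner_proj_compl // mulmxBr (mulmxA W) WB !mul0mx subr0 (inner_isometry_dim CC).
(* The part of the residual seen by [C] is dropped; off the span of [C] the matrix [Y] contributes
   nothing. *)
have hZ : inner (Y - X - W) (Y - X - W) >= inner W W.
  have := inner_ge0 ((Y - X - W) *m C).
  have := inner_proj_complr (Y - X - W) CC.
  have -> : Y - X - W - (Y - X - W) *m C *m C^T = - (X + W - (X + W) *m C *m C^T).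
    rewrite !mulmxBl !mulmxDl YC ?mulNmx; move: (X *m C *m C^T) (W *m C *m C^T) => a b.
    by apply/matrixP => i j; rewrite !mxE; ring.
  rewrite innerNl innerNr opprK inner_proj_complr // mulmxDl.
  rewrite (inner_add_orth XW0) (inner_add_orth (XWC _ C C)); lra.
by move: hZ; rewrite !inner_linear (innerC W X) (innerC W Y) XW0; lra.
Qed.

End Separation.

Section Projections.
Variables (R : realType) (n m : nat).
Implicit Types X Y Z W : 'M[R]_(n, m).

(** The bound [t] on [W] is brought to [s] by passing to [(s / t) *: W]; for [t = 0] the matrix [W]
    vanishes. *)
Lemma separation X W Y k (B : 'M[R]_(m, k)) s t : (k <= m)%N -> 0 < s -> 0 <= t ->
  expanding_frame X B s -> X^T *m W = 0 -> W *m B = 0 ->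
  (forall p (M : 'M[R]_(m, p)), inner (W *m M) (W *m M) <= t ^+ 2 * inner M M) ->
  (\rank Y <= k)%N -> 2 * s * inner Y W <= t * inner (Y - X) (Y - X).
Proof.
move=> km s0 t_ge0 XB XW WB Wt Yk.
have [t0|t0] := eqVneq t 0.
  have W0 : W = 0.
    apply/eqP; rewrite -inner_eq0 eq_le inner_ge0 andbT.
    by have := Wt _ 1%:M; rewrite mulmx1 t0 expr0n mul0r.
  by rewrite W0 inner0r t0 mulr0 mul0r.
have t_gt0 : 0 < t by rewrite lt_neqAle eq_sym t0.
have : 2 * inner Y ((s / t) *: W) <= inner (Y - X) (Y - X).
  apply: (frame_separation km XB) => //.
  - by rewrite -scalemxAr XW scaler0.
  - by rewrite -scalemxAl WB scaler0.
  move=> p M; rewrite -scalemxAl !inner_linear mulrA -expr2 exprMn exprVn -mulrA.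
  by rewrite ler_pM2l ?exprn_gt0 // ler_pdivrMl ?exprn_gt0.
rewrite innerZr => h; rewrite -(ler_pM2l t_gt0) in h; apply: le_trans h.
by rewrite le_eqVlt; apply/orP; left; apply/eqP; field.
Qed.

Lemma is_proj_inner (C : set 'M[R]_(n, m)) Z X : is_proj C Z X <->
  C X /\ forall Y, C Y -> inner (X - Z) (X - Z) <= inner (Y - Z) (Y - Z).
Proof.
have e Y : (frobenius_norm (X - Z) <= frobenius_norm (Y - Z)) =
    (inner (X - Z) (X - Z) <= inner (Y - Z) (Y - Z)).
  by rewrite -!frobenius_sq ler_sqr ?nnegrE ?frobenius_norm_ge0.
by split=> -[CX XY]; split=> // Y CY; move: (XY Y CY); rewrite e.
Qed.

Lemma separation_expand X W Y :
  X^T *m W = 0 -> inner (Y - (X + W)) (Y - (X + W)) =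
    inner (Y - X) (Y - X) - 2 * inner Y W + inner W W.
Proof.
move=> XW; have XW0 : inner X W = 0.
  by rewrite -[X]mulmx1 inner_mulmxl XW inner0r.
by rewrite !inner_linear (innerC W X) (innerC W Y) (innerC X Y) XW0; ring.
Qed.

Lemma is_proj_frame X W k (B : 'M[R]_(m, k)) s : (k <= m)%N ->
  expanding_frame X B s -> X^T *m W = 0 -> W *m B = 0 ->
  (forall p (M : 'M[R]_(m, p)), inner (W *m M) (W *m M) <= s ^+ 2 * inner M M) ->
  (\rank X <= k)%N -> is_proj (rank_le n m k) (X + W) X.
Proof.
move=> km XB XW WB Ws Xk; apply/is_proj_inner; split=> // Y Yk.
rewrite !separation_expand // subrr inner0l.
have -> : inner X W = 0 by rewrite -[X]mulmx1 inner_mulmxl XW inner0r.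
by have := frame_separation km XB XW WB Ws Yk; lra.
Qed.

(** The squared distance from [Y] to [X + W] exceeds that from [X] by at least
    [(1 - t / s) |Y - X|^2], and moving the target by [D] lowers this difference by [2 <Y - X, D>];
    Cauchy-Schwarz concludes. With [Z' = X + W] and [t < s] the bound gives uniqueness of the
    nearest point. *)
Lemma proj_lipschitz X W Z' Y k (B : 'M[R]_(m, k)) s t :
  (k <= m)%N -> 0 < s -> 0 <= t ->
  expanding_frame X B s -> X^T *m W = 0 -> W *m B = 0 ->
  (forall p (M : 'M[R]_(m, p)), inner (W *m M) (W *m M) <= t ^+ 2 * inner M M) ->
  (\rank X <= k)%N -> is_proj (rank_le n m k) Z' Y ->
  (s - t) * frobenius_norm (Y - X) <= 2 * s * frobenius_norm (Z' - (X + W)).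
Proof.
move=> km s0 t0 XB XW WB Wt Xk /is_proj_inner[Yk /(_ _ Xk) YX].
have sep := separation km s0 t0 XB XW WB Wt Yk.
have eY := separation_expand Y XW.
have eX := separation_expand X XW.
have XW0 : inner X W = 0 by rewrite -[X]mulmx1 inner_mulmxl XW inner0r.
rewrite subrr inner0l XW0 in eX.
have [D DE] : exists D, Z' - (X + W) = D by exists (Z' - (X + W)).
rewrite DE.
have e V : inner (V - Z') (V - Z') = inner (V - (X + W)) (V - (X + W))
    - 2 * inner (V - (X + W)) D + inner D D.
  have -> : V - Z' = V - (X + W) - D by rewrite -DE opprB addrA subrK.
  by rewrite !inner_linear (innerC D V) (innerC D X) (innerC D W); ring.
have h : (s - t) * inner (Y - X) (Y - X) <= 2 * s * inner (Y - X) D.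
  rewrite !e eY eX in YX.
  have {YX} : inner (Y - X) (Y - X) - 2 * inner Y W <= 2 * inner (Y - X) D.
    have -> : inner (Y - X) D = inner (Y - (X + W)) D - inner (X - (X + W)) D.
      by rewrite !inner_linear; ring.
    by move: YX; lra.
  by rewrite -(ler_pM2l s0); move: sep; lra.
have [->|YX0] := eqVneq (frobenius_norm (Y - X)) 0.
  by rewrite mulr0 !mulr_ge0 ?frobenius_norm_ge0 ?(ltW s0).
have YX_gt0 : 0 < frobenius_norm (Y - X).
  by rewrite lt_neqAle eq_sym YX0 frobenius_norm_ge0.
rewrite -(ler_pM2r YX_gt0) -(mulrA (s - t)) -expr2 frobenius_sq.
apply: le_trans h _; rewrite -!mulrA ler_pM2l // ler_pM2l //.
by rewrite mulrC inner_le_norm.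
Qed.

End Projections.

(** * Necessary conditions at a nearest point *)

Section Minimizers.
Variables (R : realType) (n m : nat).
Implicit Types X Y Z W : 'M[R]_(n, m).

Lemma quadratic_ge0_eq0 (a b : R) : 0 <= b ->
  (forall t, 0 <= t ^+ 2 * b - 2 * t * a) -> a = 0.
Proof.
(* At [t = a / (b + 1)], which makes sense for [b = 0] too, the quadratic equals
   [- (b + 2) a^2 / (b + 1)^2]. *)
move=> b0 /(_ (a / (b + 1))) h; apply/eqP; rewrite -sqrf_eq0 eq_le sqr_ge0 andbT.
have b1 : 0 < b + 1 by rewrite ltr_wpDl.
have : 0 <= (b + 1) ^+ 2 * ((a / (b + 1)) ^+ 2 * b - 2 * (a / (b + 1)) * a).
  by rewrite mulr_ge0 ?sqr_ge0.
rewrite (_ : _ * _ = - (b + 2) * a ^+ 2); last by field; rewrite gt_eqF.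
by rewrite mulNr oppr_ge0 pmulr_rle0 // ltr_wpDl.
Qed.

Lemma mulmx_trmx_eq0 p q l (A : 'M[R]_(p, q)) (B : 'M[R]_(l, q)) :
  A *m B^T = 0 -> B *m A^T = 0.
Proof. by move=> AB; apply: trmx_inj; rewrite trmx_mul trmxK AB trmx0. Qed.

Lemma is_proj_rank_orth k Z X : is_proj (rank_le n m k) Z X ->
  X^T *m (Z - X) = 0 /\ (Z - X) *m X^T = 0.
Proof.
move=> /is_proj_inner[Xk ZX].
have orth Y : (forall t, \rank (X + t *: Y)%R <= k)%N -> inner Y (Z - X) = 0.
  move=> Yk; apply: (@quadratic_ge0_eq0 _ (inner Y Y)); first exact: inner_ge0.
  move=> t; have := ZX (X + t *: Y) (Yk t); rewrite -subr_ge0.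
  move=> h; apply: le_trans h _; rewrite le_eqVlt; apply/orP; left; apply/eqP.
  rewrite !inner_linear (innerC Y X) (innerC Z Y) (innerC Z X); ring.
split; apply/eqP; rewrite -inner_eq0; apply/eqP.
  (* The variation is [X *m (X^T *m (Z - X))]: it keeps the left factor [X], hence the rank bound,
     and its pairing with [Z - X] is [|X^T (Z - X)|^2]. *)
  rewrite inner_mulmxl trmxK innerC; apply: orth => t.
  rewrite -[X in X + _]mulmx1 scalemxAr -mulmxDr.
  exact: leq_trans (mxrankM_maxl _ _) Xk.
rewrite inner_mulmxr trmxK innerC; apply: orth => t.
rewrite -[X in X + _]mul1mx scalemxAl -mulmxDl.
exact: leq_trans (mxrankM_maxr _ _) Xk.
Qed.

(* Otherwise trading the last singular triple of [X] for the first one of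
   [Z - X] would decrease the distance to [Z]. *)
Lemma is_proj_rank_gap k Z X : (k < m)%N -> is_proj (rank_le n m k.+1) Z X ->
  spectral_norm (Z - X) <= sigma k.+1 X.
Proof.
move=> km ZX; have [XW WX] := is_proj_rank_orth ZX.
move/is_proj_inner: ZX => [Xk ZX]; have [W WE] : exists W, Z - X = W by exists (Z - X).
rewrite WE in XW WX *.
rewrite leNgt; apply/negP => lt_sW.
have m0 : (0 < m)%N by case: (m) km.
have [u [v [vv uu Xv Xu Xrk]]] := singular_pair X km.
have [w [z [zz ww Wz Ww _]]] := singular_pair W m0.
rewrite -/(spectral_norm W) in ww Wz Ww; set s := sigma _ X in uu Xv Xu Xrk lt_sW.
set a := spectral_norm W in ww Wz Ww lt_sW.
have s_ge0 : 0 <= s by exact: sigma_ge0.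
have a_gt0 : 0 < a by exact: le_lt_trans lt_sW.
have {}ww : inner w w = 1 by rewrite ww gt_eqF.
have Xz : X *m z = 0.
  apply/eqP; rewrite -[_ == 0](inj_eq (scalerI (lt0r_neq0 a_gt0))) scaler0.
  by rewrite scalemxAr -Ww mulmxA (mulmx_trmx_eq0 WX) mul0mx.
(* The factor [s] stays in [f1] and [f3]: when [s = 0] the vector [v] need not be orthogonal to
   [z]. *)
have f1 : s * inner u (W *m v) = 0.
  by rewrite -innerZr scalemxAr -Xu mulmxA WX mul0mx inner0r.
have f2 : inner w (W *m z) = a by rewrite Wz innerZr ww mulr1.
have f3 : s * inner v z = 0.
  by rewrite -innerZl -Xu inner_mulmxl trmxK Xz inner0r.
pose X' := X - s *: (u *m v^T) + (a *: w) *m z^T.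
have X'k : (\rank X' <= k.+1)%N.
  apply: leq_trans (mxrank_add _ _) _; rewrite -[k.+1]addn1 leq_add ?Xrk //.
  by apply: leq_trans (mxrankM_maxl _ _) _; exact: rank_leq_col.
have := ZX _ X'k.
have -> : X' - Z = - (W + s *: (u *m v^T) - a *: (w *m z^T)).
  rewrite /X' -WE -scalemxAl; move: (s *: _) (a *: _) => P Q.
  by apply/matrixP => i j; rewrite !mxE; ring.
have -> : X - Z = - W by rewrite -WE opprB.
rewrite innerNl innerNr opprK [in X in _ <= X]innerNl innerNr opprK.
apply/negP; rewrite -ltNge.
have WP : s * inner W (u *m v^T) = 0 by rewrite innerC inner_rank1.
have WQ : inner W (w *m z^T) = a by rewrite innerC inner_rank1.
have PQ : s * inner (u *m v^T) (w *m z^T) = 0.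
  by rewrite inner_rank1_rank1 mulrCA f3 mulr0.
have QQ : inner (w *m z^T) (w *m z^T) = 1 by rewrite inner_rank1_rank1 ww zz mulr1.
have PP : inner (u *m v^T) (u *m v^T) <= 1.
  by rewrite inner_rank1_rank1 uu vv mulr1; case: eqP; rewrite ?ler01.
move: (u *m v^T) (w *m z^T) WP WQ PQ QQ PP => P Q WP WQ PQ QQ PP.
(* Once the cross terms with [P] vanish, the exchange changes the squared distance by
   [s^2 |P|^2 - a^2], negative because [|P| <= 1] and [s < a]. *)
have -> : inner (W + s *: P - a *: Q) (W + s *: P - a *: Q) =
    inner W W + s ^+ 2 * inner P P + a ^+ 2 * inner Q Q + 2 * (s * inner W P)
    - 2 * a * inner W Q - 2 * a * (s * inner P Q).
  by rewrite !inner_linear (innerC P W) (innerC Q W) (innerC Q P); ring.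
rewrite WP WQ PQ QQ.
have s2a2 : s ^+ 2 < a ^+ 2 by rewrite ltr_sqr ?nnegrE // ltW.
have : s ^+ 2 * inner P P <= s ^+ 2 by rewrite ler_piMr ?sqr_ge0.
by lra.
Qed.

(** If the spectral norm of [Z - X] is positive, [Z] stretches by at least that much on the span of
    the first [k.+1] right singular vectors of [X] and the top one of [Z - X]. This space has
    dimension [k + 2], so [Y] kills a unit vector in it, where [Z - Y] acts as [Z]. *)
Lemma spectral_norm_proj_le k Z X Y : (k < m)%N ->
  is_proj (rank_le n m k.+1) Z X -> (\rank Y <= k.+1)%N ->
  spectral_norm (Z - X) <= spectral_norm (Z - Y).
Proof.
move=> km ZX Yk; have [XW WX] := is_proj_rank_orth ZX.
have gap := is_proj_rank_gap km ZX.
have Xk : (\rank X <= k.+1)%N by case: ZX.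
have ZE : Z = X + (Z - X) by rewrite addrC subrK.
move: (Z - X) ZE XW WX gap => W ZE XW WX gap.
have [->|W0] := eqVneq (spectral_norm W) 0; first exact: sigma_ge0.
have W_gt0 : 0 < spectral_norm W by rewrite lt_neqAle eq_sym W0 sigma_ge0.
have s0 : sigma k.+1 X != 0 by rewrite gt_eqF // (lt_le_trans W_gt0).
have m0 : (0 < m)%N by case: (m) km.
have [w [z [zz ww Wz Ww _]]] := singular_pair W m0.
rewrite -/(spectral_norm W) W0 in ww Wz Ww.
have [B [BB _ XB]] := rank_le_row_isometry km Xk.
have frB : expanding_frame X B (sigma k.+1 X) by [].
have Xz : X *m z = 0.
  apply/eqP; rewrite -[_ == 0](inj_eq (scalerI W0)) scaler0.
  by rewrite scalemxAr -Ww mulmxA (mulmx_trmx_eq0 WX) mul0mx.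
have Bz : B^T *m z = 0 by exact: expanding_frame_kernel frB s0 Xz.
have WB : W *m B = 0.
  apply: trmx_inj; rewrite trmx0 trmx_mul; apply: expanding_frame_kernel frB s0 _.
  by apply: trmx_inj; rewrite trmx_mul trmxK WX trmx0.
pose C := row_mx B z.
have CC : C^T *m C = 1%:M.
  rewrite tr_row_mx mul_col_row BB Bz mul_tr_inner zz.
  have -> : z^T *m B = 0 by apply: trmx_inj; rewrite trmx_mul trmxK Bz trmx0.
  by rewrite -scalar_mx_block.
have [c [cc Yc]] : exists c : 'cV[R]_(k.+1 + 1), inner c c = 1 /\ Y *m C *m c = 0.
  apply: unit_kernel_vector.
  apply: (@leq_ltn_trans k.+1); last by rewrite addn1.
  exact: leq_trans (mxrankM_maxl _ _) Yk.
have x1 : inner (C *m c) (C *m c) = 1 by rewrite inner_isometry.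
rewrite -ler_sqr ?nnegrE ?sigma_ge0 //.
have := spectral_norm_mulmx (Z - Y) (C *m c).
rewrite x1 mulr1 mulmxBl [Y *m _]mulmxA Yc subr0 => h; apply: le_trans h.
have [a [b ce]] : exists a b, c = col_mx a b.
  by exists (usubmx c), (dsubmx c); rewrite vsubmxK.
have ab : inner a a + inner b b = 1.
  by rewrite -cc ce /inner tr_col_mx mul_row_col mxtraceD.
rewrite ce mul_row_col ZE mulmxDl !mulmxDr (mulmxA W) WB mul0mx add0r.
rewrite (mulmxA X z) Xz mul0mx addr0 inner_add_orth; last first.
  by rewrite inner_mulmxl mulmxA XW mul0mx inner0r.
have hX : spectral_norm W ^+ 2 * inner a a <= inner (X *m (B *m a)) (X *m (B *m a)).
  apply: le_trans (_ : sigma k.+1 X ^+ 2 * inner a a <= _).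
    by rewrite ler_wpM2r ?inner_ge0 // ler_sqr ?nnegrE ?sigma_ge0.
  by have := XB _ (B *m a); rewrite mulmxA BB mul1mx.
have hW : inner (W *m (z *m b)) (W *m (z *m b)) = spectral_norm W ^+ 2 * inner b b.
  rewrite mulmxA Wz -scalemxAl !inner_linear inner_isometry; first by ring.
  by rewrite mul_tr_inner ww.
by rewrite hW -[leLHS]mulr1 -ab mulrDr lerD2r.
Qed.

(** A Weyl inequality. Cutting the last triple of [Y] leaves a matrix that kills a unit vector in
    the span of [B], where [X] stretches by at least [sigma k.+1 X]; the cut costs at most
    [sigma k.+1 Y]. *)
Lemma sigma_perturbation k X Y : (k < m)%N -> (\rank Y <= k.+1)%N ->
  (\rank X <= k.+1)%N ->
  sigma k.+1 X <= frobenius_norm (X - Y) + sigma k.+1 Y.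
Proof.
move=> km Yk Xk; have [u [v [vv uu Yv Yu /(_ Yk) Yrk]]] := singular_pair Y km.
have [B [BB _ XB]] := rank_le_row_isometry km Xk.
set Y' := Y - _ in Yrk.
have [c [cc Yc]] : exists c : 'cV[R]_k.+1, inner c c = 1 /\ Y' *m B *m c = 0.
  by apply: unit_kernel_vector; rewrite ltnS (leq_trans (mxrankM_maxl _ _)).
have h1 : sigma k.+1 X <= frobenius_norm ((X - Y') *m (B *m c)).
  rewrite mulmxBl [Y' *m _]mulmxA Yc subr0 -ler_sqr ?nnegrE ?sigma_ge0 ?frobenius_norm_ge0 //.
  rewrite frobenius_sq; have := XB _ (B *m c).
  by rewrite mulmxA BB mul1mx cc mulr1.
apply: le_trans h1 _; apply: le_trans (frobenius_norm_mulmx _ _) _.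
have -> : frobenius_norm (B *m c) = 1.
  by rewrite /frobenius_norm inner_isometry // cc sqrtr1.
rewrite mulr1 /Y' opprB addrCA addrC; apply: le_trans (frobenius_triangle _ _) _.
rewrite lerD2l frobenius_normZ ger0_norm ?sigma_ge0 //.
rewrite -[leRHS]mulr1 ler_wpM2l ?sigma_ge0 //; apply: frobenius_norm_le; first exact: ler01.
by rewrite inner_rank1_rank1 vv uu mulr1 expr1n; case: eqP; rewrite ?ler01.
Qed.

End Minimizers.

(** * Continuity of the projection *)

Section FrobeniusTopology.
Variables (R : realType) (n m : nat).
Implicit Types (X Y Z : 'M[R]_(n, m)) (U : set 'M[R]_(n, m)).

Lemma entry_le_frobenius X i j : `|X i j| <= frobenius_norm X.
Proof.
rewrite -ler_sqr ?nnegrE ?frobenius_norm_ge0 // frobenius_sq innerE real_normK ?num_real //.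
rewrite (bigD1 i) //= (bigD1 j) //= -expr2 -addrA lerDl.
by apply: addr_ge0; repeat (apply: sumr_ge0 => ? _); rewrite -expr2 sqr_ge0.
Qed.

Lemma nbhs_frobenius X U : nbhs X U <->
  exists2 e, 0 < e & forall Y, frobenius_norm (Y - X) < e -> U Y.
Proof.
split=> [/nbhs_ballP[e /= e0 XU]|[e e0 XU]].
  exists e => // Y YX; apply: XU; split=> // i j; rewrite /ball /=.
  have := entry_le_frobenius (Y - X) i j; rewrite !mxE distrC => h.
  exact: le_lt_trans h YX.
(* Entries below [e / (c + 1)] give a squared norm of at most [c (e / (c + 1))^2 < e^2]; adding 1
   covers empty matrices. *)
pose c : R := (n * m)%:R; have c0 : 0 <= c by rewrite ler0n.
have c1 : 0 < c + 1 by rewrite ltr_wpDl.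
apply/nbhs_ballP; exists (e / (c + 1)) => /=; first by rewrite divr_gt0.
move=> Y [_ YX]; apply: XU.
rewrite -ltr_sqr ?nnegrE ?frobenius_norm_ge0 ?ltW // frobenius_sq innerE.
apply: (@le_lt_trans _ _ (c * (e / (c + 1)) ^+ 2)).
  rewrite [X in X * _](_ : c = \sum_(i < n) \sum_(j < m) 1); last first.
    by rewrite !sumr_const !card_ord /c mulrnA mulrnAC -!mulrnA mulnC.
  rewrite mulr_suml; apply: ler_sum => i _; rewrite mulr_suml; apply: ler_sum => j _.
  rewrite mul1r -expr2 -real_normK ?num_real // ler_sqr ?nnegrE //; last first.
    by rewrite divr_ge0 ?ltW.
  by have := YX i j; rewrite /ball /= distrC !mxE => /ltW.
rewrite expr_div_n mulrCA gtr_pMr ?exprn_gt0 //.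
rewrite ltr_pdivrMr ?exprn_gt0 // mul1r sqrrD expr1n mulr1.
by have := sqr_ge0 c; lra.
Qed.

Lemma continuous_frobenius (P : 'M[R]_(n, m) -> 'M[R]_(n, m)) X :
  {for X, continuous P} <-> forall e, 0 < e -> exists2 d, 0 < d &
    forall Y, frobenius_norm (Y - X) < d -> frobenius_norm (P Y - P X) < e.
Proof.
split=> [PX e e0|PX A /nbhs_frobenius[e e0 PA]].
  have : nbhs (P X) [set Y | frobenius_norm (Y - P X) < e].
    by apply/nbhs_frobenius; exists e.
  by move=> /PX /nbhs_frobenius[d d0 dP]; exists d.
have [d d0 dP] := PX e e0.
by apply/nbhs_frobenius; exists d => // Y /dP /PA.
Qed.

End FrobeniusTopology.

(** * Regularity where the last singular value is positive *)

Section Regular.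
Variables (R : realType) (n m k : nat).
Hypothesis km : (k < m)%N.
Implicit Types X Y Z W : 'M[R]_(n, m).

Lemma is_proj_expanding_frame Z X : is_proj (rank_le n m k.+1) Z X ->
  sigma k.+1 X != 0 -> exists B : 'M[R]_(m, k.+1),
    expanding_frame X B (sigma k.+1 X) /\ (Z - X) *m B = 0.
Proof.
move=> ZX s0; have [_ WX] := is_proj_rank_orth ZX.
have Xk : (\rank X <= k.+1)%N by case: ZX.
have [B [BB _ XB]] := rank_le_row_isometry km Xk.
have frB : expanding_frame X B (sigma k.+1 X) by [].
exists B; split=> //; apply: trmx_inj; rewrite trmx0 trmx_mul.
by apply: expanding_frame_kernel frB s0 _; exact: mulmx_trmx_eq0.
Qed.

(** This is [separation] with [W = Z - X] and [t] its spectral norm; [<Y - X, W> = <Y, W>] because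
    [W] is orthogonal to [X]. *)
Lemma concavity_coeff_upper Z X Y : is_proj (rank_le n m k.+1) Z X ->
  0 < sigma k.+1 X -> (\rank Y <= k.+1)%N ->
  inner (Y - X) (Z - X) <=
    (2 * sigma k.+1 X)^-1 * (spectral_norm (Z - X) * frobenius_norm (Y - X) ^+ 2).
Proof.
move=> ZX s0 Yk; have [XW _] := is_proj_rank_orth ZX.
have [B [XB WB]] := is_proj_expanding_frame ZX (lt0r_neq0 s0).
have := separation km s0 (sigma_ge0 1 (Z - X)) XB XW WB (spectral_norm_mulmx (Z - X)) Yk.
rewrite ler_pdivlMl ?mulr_gt0 // frobenius_sq => h.
have XW0 : inner X (Z - X) = 0 by rewrite -[X in inner X _]mulmx1 inner_mulmxl XW inner0r.
by rewrite innerDl innerNl XW0 subr0.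
Qed.

Lemma continuous_projection P Z : projection_onto (rank_le n m k.+1) P ->
  spectral_norm (Z - P Z) < sigma k.+1 (P Z) ->
  {for Z, continuous P}.
Proof.
move=> hP gap; apply/continuous_frobenius => e e0.
set s := sigma k.+1 (P Z) in gap; set t := spectral_norm _ in gap.
have s0 : 0 < s by apply: le_lt_trans gap; exact: sigma_ge0.
have st : 0 < s - t by rewrite subr_gt0.
have [XW _] := is_proj_rank_orth (hP Z).
have [B [XB WB]] := is_proj_expanding_frame (hP Z) (lt0r_neq0 s0).
exists ((s - t) * e / (2 * s)); first by rewrite divr_gt0 ?mulr_gt0.
move=> Y; rewrite ltr_pdivlMr ?mulr_gt0 // mulrC => YZ.
rewrite -(ltr_pM2l st); apply: le_lt_trans YZ.
have Xk : (\rank (P Z) <= k.+1)%N by case: (hP Z).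
have := proj_lipschitz km s0 (sigma_ge0 1 (Z - P Z)) XB XW WB
  (spectral_norm_mulmx (Z - P Z)) Xk (hP Y).
by rewrite [P Z + _]addrC subrK.
Qed.

Lemma regular_not_degenerate P X : projection_onto (rank_le n m k.+1) P ->
  rank_le n m k.+1 X -> 0 < sigma k.+1 X -> ~ degenerate (rank_le n m k.+1) P X.
Proof.
move=> hP Xk s0 [_]; apply.
set s := sigma k.+1 X in s0.
(* If [|Z - X| < s / 4], then [|Z - P Z| < s / 4], while [P Z] lies within [s / 2] of [X], so that
   [sigma k.+1 (P Z)] still exceeds [s / 2]. *)
exists [set Z | frobenius_norm (Z - X) < s / 4]; split.
  by apply/nbhs_frobenius; exists (s / 4); rewrite ?divr_gt0.
apply: continuous_in_subspaceT => Z; rewrite inE /= => ZX.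
apply: continuous_projection => //.
have [PZk /(_ _ Xk) PZ] := hP Z.
have PZX : frobenius_norm (X - P Z) <= 2 * frobenius_norm (Z - X).
  have -> : X - P Z = (X - Z) + (- (P Z - Z)) by rewrite opprB addrA subrK.
  apply: le_trans (frobenius_triangle _ _) _.
  move: PZ; rewrite frobenius_normN -(frobenius_normN (X - Z)) opprB; lra.
have := sigma_perturbation km PZk Xk; rewrite -/s.
have := spectral_norm_le_frobenius (Z - P Z).
move: PZ; rewrite -(frobenius_normN (X - Z)) -(frobenius_normN (P Z - Z)) !opprB.
by lra.
Qed.

End Regular.

(** * Discontinuity at matrices of deficient rank *)

Section Degenerate.
Variables (R : realType) (n m : nat).
Implicit Types X Y Z W : 'M[R]_(n, m).

Lemma mxrank_sigma0 X k : (k < m)%N -> (\rank X <= k.+1)%N -> sigma k.+1 X = 0 ->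
  (\rank X <= k)%N.
Proof.
move=> km Xk s0; have [u [v [_ _ _ _ /(_ Xk)]]] := singular_pair X km.
by rewrite s0 scale0r subr0.
Qed.

Lemma singular_complement X : (\rank X < minn n m)%N ->
  exists (u : 'cV[R]_n) (v : 'cV[R]_m),
    [/\ inner u u = 1, inner v v = 1, X^T *m u = 0 & X *m v = 0].
Proof.
rewrite leq_min => /andP[Xn Xm].
have [v [vv Xv]] := unit_kernel_vector Xm.
rewrite -mxrank_tr in Xn; have [u [uu Xu]] := unit_kernel_vector Xn.
by exists u, v.
Qed.

(** Multiplying by [u^T] shows that [v^T] enters the row space, whereas every row of [X] is
    orthogonal to [v]; the new row space strictly contains the old one. *)
Lemma mxrank_rank1_update X d (u : 'cV[R]_n) (v : 'cV[R]_m) : d != 0 ->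
  inner u u = 1 -> inner v v = 1 -> X^T *m u = 0 -> X *m v = 0 ->
  \rank (X + d *: (u *m v^T))%R = (\rank X).+1.
Proof.
move=> d0 uu vv Xu Xv; apply/eqP; rewrite eqn_leq; apply/andP; split.
  apply: leq_trans (mxrank_add _ _) _; rewrite -[(\rank X).+1]addn1 leq_add //.
  rewrite scalemxAl; apply: leq_trans (mxrankM_maxl _ _) _; exact: rank_leq_col.
apply: rank_ltmx; rewrite ltmxE.
have uX : u^T *m X = 0 by apply: trmx_inj; rewrite trmx_mul trmxK Xu trmx0.
set Y := X + _.
have vY : (v^T <= Y)%MS.
  apply/submxP; exists (d^-1 *: u^T).
  rewrite /Y mulmxDr -scalemxAl uX scaler0 add0r -scalemxAl -scalemxAr scalerA mulVf //.
  by rewrite scale1r mulmxA mul_tr_inner uu mul1mx.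
apply/andP; split.
  have -> : X = Y + (- d *: u) *m v^T by rewrite /Y -scalemxAl scaleNr addrK.
  by rewrite addmx_sub // mulmx_sub.
apply/negP => YX; have /submxP[a va] := submx_trans vY YX.
have : v^T *m v = 0 by rewrite va -mulmxA Xv mulmx0.
by rewrite mul_tr_inner vv => /matrixP /(_ 0 0) /eqP; rewrite !mxE eqxx oner_eq0.
Qed.

Lemma frobenius_rank1 (u : 'cV[R]_n) (v : 'cV[R]_m) d : 0 <= d ->
  inner u u = 1 -> inner v v = 1 -> frobenius_norm (d *: (u *m v^T)) = d.
Proof.
move=> d0 uu vv; rewrite frobenius_normZ ger0_norm // /frobenius_norm.
by rewrite inner_rank1_rank1 uu vv mulr1 sqrtr1 mulr1.
Qed.

(** The rank is raised one step at a time by a small rank-one term orthogonal on both sides, which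
    takes half of the tolerance left. *)
Lemma mxrank_dense k X e : (k <= minn n m)%N -> (\rank X <= k)%N -> 0 < e ->
  exists2 Y, frobenius_norm (Y - X) < e & \rank Y = k.
Proof.
elim: k e => [|k IH] e km Xk e0.
  exists X; first by rewrite subrr frobenius_norm0.
  by apply/eqP; rewrite -leqn0.
move: Xk; rewrite leq_eqVlt => /orP[/eqP Xk|Xk].
  by exists X; first by rewrite subrr frobenius_norm0.
have [|||Y YX Yk] := IH (e / 2); rewrite ?divr_gt0 //; first exact: ltnW.
have [u [v [uu vv Yu Yv]]] := @singular_complement Y ltac:(by rewrite Yk).
have e2 : 0 < e / 2 by rewrite divr_gt0.
exists (Y + (e / 2) *: (u *m v^T)); last first.
  by rewrite mxrank_rank1_update ?Yk // gt_eqF.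
rewrite addrAC; apply: le_lt_trans (frobenius_triangle _ _) _.
rewrite frobenius_rank1 ?(ltW e2) //; move: YX; lra.
Qed.

(** [A = X + a u v^T] has the frame formed by [B] and [v] with factor [min(a, s)], which exceeds the
    bound [b] on the remaining term [W]. The Lipschitz bound at [A + W] itself then forces
    [Y = A]. *)
Lemma is_proj_two_rank1 X k (B : 'M[R]_(m, k)) s a b
    (u u' : 'cV[R]_n) (v v' : 'cV[R]_m) Y :
  (k < m)%N -> (\rank X <= k)%N -> expanding_frame X B s ->
  inner u u = 1 -> inner v v = 1 -> X^T *m u = 0 -> X *m v = 0 ->
  inner u' u' = 1 -> inner v' v' = 1 -> X^T *m u' = 0 -> X *m v' = 0 ->
  inner u u' = 0 -> inner v v' = 0 ->
  0 < b -> b < a -> b < s ->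
  is_proj (rank_le n m k.+1) (X + a *: (u *m v^T) + b *: (u' *m v'^T)) Y ->
  Y = X + a *: (u *m v^T).
Proof.
move=> km Xk XB uu vv Xu Xv uu' vv' Xu' Xv' uv uv' b0 ba bs ZY.
have s0 : 0 < s by apply: lt_trans bs.
have a0 : 0 < a by apply: lt_trans ba.
have BB : B^T *m B = 1%:M by case: XB.
have Bv : B^T *m v = 0 by apply: expanding_frame_kernel XB (lt0r_neq0 s0) Xv.
have Bv' : B^T *m v' = 0 by apply: expanding_frame_kernel XB (lt0r_neq0 s0) Xv'.
have vB : v^T *m B = 0 by apply: trmx_inj; rewrite trmx_mul trmxK Bv trmx0.
have vB' : v'^T *m B = 0 by apply: trmx_inj; rewrite trmx_mul trmxK Bv' trmx0.
set A := X + a *: (u *m v^T) in ZY *; set W := b *: (u' *m v'^T) in ZY.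
pose c := Num.min a s; have c0 : 0 < c by rewrite lt_min a0.
have bc : b < c by rewrite lt_min ba.
have frA : expanding_frame A (row_mx B v) c.
  split.
    by rewrite tr_row_mx mul_col_row BB Bv vB mul_tr_inner vv -scalar_mx_block.
  move=> p M; rewrite tr_row_mx mul_col_mx.
  have -> : inner (col_mx (B^T *m M) (v^T *m M)) (col_mx (B^T *m M) (v^T *m M)) =
      inner (B^T *m M) (B^T *m M) + inner (v^T *m M) (v^T *m M).
    by rewrite /inner tr_col_mx mul_row_col mxtraceD.
  rewrite /A mulmxDl inner_add_orth; last first.
    by rewrite -scalemxAl innerZr inner_mulmxl !mulmxA Xu !mul0mx inner0r mulr0.
  rewrite -scalemxAl !inner_linear -mulmxA [inner (u *m _) _]inner_isometry; last first.
    by rewrite mul_tr_inner uu.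
  rewrite mulrDr; apply: lerD.
    have [_ h] := XB; apply: le_trans (h _ _); apply: ler_wpM2r; first exact: inner_ge0.
    by rewrite ler_sqr ?nnegrE ?(ltW c0) ?(ltW s0) // ge_min lexx orbT.
  rewrite mulrA -expr2; apply: ler_wpM2r; first exact: inner_ge0.
  by rewrite ler_sqr ?nnegrE ?(ltW c0) ?(ltW a0) // ge_min lexx.
have AW : A^T *m W = 0.
  rewrite /A linearD /= [(a *: _)^T]linearZ /= trmx_mul trmxK mulmxDl -scalemxAl.
  rewrite /W -!scalemxAr !mulmxA Xu' -(mulmxA v) mul_tr_inner uv raddf0.
  by rewrite mulmx0 !mul0mx !scaler0 addr0.
have WB : W *m row_mx B v = 0.
  rewrite /W -scalemxAl -mulmxA mul_mx_row vB' mul_tr_inner innerC uv'.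
  by rewrite raddf0 row_mx0 mulmx0 scaler0.
have Wb p (M : 'M[R]_(m, p)) : inner (W *m M) (W *m M) <= b ^+ 2 * inner M M.
  apply: le_trans (spectral_norm_mulmx _ _) _; apply: ler_wpM2r; first exact: inner_ge0.
  rewrite ler_sqr ?nnegrE ?sigma_ge0 ?(ltW b0) //.
  by apply: le_trans (spectral_norm_le_frobenius _) _; rewrite frobenius_rank1 // ltW.
have Ak : (\rank A <= k + 1)%N.
  by rewrite mxrank_rank1_update ?gt_eqF // addn1.
rewrite -[k.+1]addn1 in ZY.
have := proj_lipschitz _ c0 (ltW b0) frA AW WB Wb Ak ZY.
rewrite subrr frobenius_norm0 mulr0 addn1 => /(_ km).
rewrite pmulr_rle0 ?subr_gt0 // => h; apply/eqP; rewrite -subr_eq0 -frobenius_norm_eq0.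
by rewrite eq_le h frobenius_norm_ge0.
Qed.

Lemma rank_deficient_degenerate k P X : (k.+1 < minn n m)%N ->
  projection_onto (rank_le n m k.+1) P -> (\rank X <= k)%N ->
  degenerate (rank_le n m k.+1) P X.
Proof.
move=> km hP Xk; split; first exact: leq_trans Xk _.
move=> [U [/nbhs_frobenius[e e0 XU] PU]].
have [Y YX Yk] := @mxrank_dense k X (e / 2) ltac:(lia) Xk ltac:(by rewrite divr_gt0).
have [u [v [uu vv Yu Yv]]] := @singular_complement Y ltac:(lia).
(* Taking the second pair in the complement of [Y1] makes it orthogonal to [Y] and to the first pair
   at once. *)
pose Y1 := Y + 1 *: (u *m v^T).
have Y1k : \rank Y1 = k.+1 by rewrite mxrank_rank1_update ?Yk ?oner_eq0.
have [u' [v' [uu' vv' Yu1' Yv1']]] := @singular_complement Y1 ltac:(by rewrite Y1k).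
have uY : u^T *m Y = 0 by apply: trmx_inj; rewrite trmx_mul trmxK Yu trmx0.
have vY : v^T *m Y^T = 0 by apply: trmx_inj; rewrite trmx_mul !trmxK Yv trmx0.
have vv0 : inner v v' = 0.
  have : u^T *m (Y1 *m v') = 0 by rewrite Yv1' mulmx0.
  rewrite mulmxA /Y1 scale1r mulmxDr uY add0r mulmxA mul_tr_inner uu mul1mx.
  by rewrite mul_tr_inner => /matrixP /(_ 0 0); rewrite !mxE.
have uu0 : inner u u' = 0.
  have : v^T *m (Y1^T *m u') = 0 by rewrite Yu1' mulmx0.
  rewrite mulmxA /Y1 scale1r linearD /= mulmxDr vY add0r trmx_mul trmxK mulmxA.
  rewrite mul_tr_inner vv mul1mx.
  by rewrite mul_tr_inner => /matrixP /(_ 0 0); rewrite !mxE.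
have Yv' : Y *m v' = 0.
  by move: Yv1'; rewrite /Y1 scale1r mulmxDl -mulmxA mul_tr_inner vv0 raddf0 mulmx0 addr0.
have Yu' : Y^T *m u' = 0.
  move: Yu1'; rewrite /Y1 scale1r linearD /= trmx_mul trmxK mulmxDl -mulmxA.
  by rewrite mul_tr_inner uu0 raddf0 mulmx0 addr0.
have [s [B [s0 YB]]] : exists s (B : 'M[R]_(m, k)), 0 < s /\ expanding_frame Y B s.
  have [B [BB _ YB]] := @rank_le_row_isometry _ _ _ Y k ltac:(lia) ltac:(by rewrite Yk).
  (* For [k = 0] the frame is empty and [s = 1] serves; [sigma 0 Y] would read the top singular
     value, which is 0 here. *)
  have [k0|k0] := posnP k.
    exists 1, B; split; first exact: ltr01.
    split=> // p M; have -> : inner (B^T *m M) (B^T *m M) = 0.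
      by rewrite innerE big1 // => -[i ik]; exfalso; move: ik; rewrite k0.
    by rewrite mulr0 inner_ge0.
  exists (sigma k Y), B; split=> //.
  rewrite lt_neqAle sigma_ge0 andbT eq_sym; apply/eqP => s0.
  have := @mxrank_sigma0 Y k.-1; rewrite prednK // Yk => /(_ _ _ s0); lia.
(* [d < s] is the gap for [is_proj_two_rank1]; [d <= e / 8] keeps [Z] within [3 e / 4] of [X], so
   that the ball of radius [e / 4] about [Z] stays in [U]. *)
pose d := Num.min (s / 2) (e / 8).
have d0 : 0 < d by rewrite lt_min !divr_gt0.
have ds : d < s by apply: (@le_lt_trans _ _ (s / 2)); [rewrite ge_min lexx|lra].
have de : d <= e / 8 by rewrite ge_min lexx orbT.
pose Q := u *m v^T; pose Q' := u' *m v'^T.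
have km' : (k < m)%N by lia.
have Yk' : (\rank Y <= k)%N by rewrite Yk.
have PQ t : 0 < t -> P (Y + (d + t) *: Q + d *: Q') = Y + (d + t) *: Q.
  move=> t0; apply: (is_proj_two_rank1 km' Yk' YB) (hP _) => //.
  by rewrite ltrDl.
have PQ' t : 0 < t -> P (Y + (d + t) *: Q' + d *: Q) = Y + (d + t) *: Q'.
  move=> t0; apply: (is_proj_two_rank1 km' Yk' YB) (hP _) => //.
  - by rewrite innerC.
  - by rewrite innerC.
  - by rewrite ltrDl.
(* [Z] is the tie: increasing either coefficient, however little, makes [P] keep that term and drop
   the other. *)
pose Z := Y + d *: Q + d *: Q'.
have nQ t : 0 <= t -> frobenius_norm (t *: Q) = t by move=> ?; exact: frobenius_rank1.
have nQ' t : 0 <= t -> frobenius_norm (t *: Q') = t by move=> ?; exact: frobenius_rank1.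
have ZX : frobenius_norm (Z - X) < e / 2 + d + d.
  have -> : Z - X = (Y - X) + d *: Q + d *: Q'.
    by rewrite /Z; apply/matrixP => i j; rewrite !mxE; ring.
  apply: le_lt_trans (frobenius_triangle _ _) _.
  apply: le_lt_trans (lerD (frobenius_triangle _ _) (lexx _)) _.
  by rewrite nQ ?nQ' ?(ltW d0) //; move: YX; lra.
have PZ : {for Z, continuous P}.
  have := @continuous_subspaceW _ _ _ _ P (@interior_subset _ U) PU.
  rewrite continuous_open_subspace; last exact: open_interior.
  apply; rewrite inE /interior /=; apply/nbhs_frobenius.
  exists (e / 4); first by rewrite divr_gt0.
  move=> V VZ; apply: XU.
  have -> : V - X = (V - Z) + (Z - X) by rewrite addrA subrK.
  by apply: le_lt_trans (frobenius_triangle _ _) _; move: VZ ZX de; lra.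
have [t t0 Pt] := (continuous_frobenius P Z).1 PZ (d / 2) ltac:(by rewrite divr_gt0).
have t2 : 0 < t / 2 by rewrite divr_gt0.
have h1 : frobenius_norm (Y + (d + t / 2) *: Q - P Z) < d / 2.
  rewrite -PQ //; apply: Pt.
  have -> : Y + (d + t / 2) *: Q + d *: Q' - Z = (t / 2) *: Q.
    by rewrite /Z; apply/matrixP => i j; rewrite !mxE; ring.
  by rewrite nQ ?ltW //; lra.
have h2 : frobenius_norm (Y + (d + t / 2) *: Q' - P Z) < d / 2.
  rewrite -PQ' //; apply: Pt.
  have -> : Y + (d + t / 2) *: Q' + d *: Q - Z = (t / 2) *: Q'.
    by rewrite /Z; apply/matrixP => i j; rewrite !mxE; ring.
  by rewrite nQ' ?ltW //; lra.
(* Continuity puts the two values of [P] at distance less than [d], but [|Q - Q'|^2 = 2] puts them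
   more than [d] apart. *)
have : frobenius_norm ((d + t / 2) *: (Q - Q')) < d.
  have -> : (d + t / 2) *: (Q - Q') = (Y + (d + t / 2) *: Q - P Z)
      + - (Y + (d + t / 2) *: Q' - P Z).
    by apply/matrixP => i j; rewrite !mxE; ring.
  apply: le_lt_trans (frobenius_triangle _ _) _; rewrite frobenius_normN.
  by move: h1 h2; lra.
have QQ : inner (Q - Q') (Q - Q') = 2.
  by rewrite !inner_linear !inner_rank1_rank1 uu vv uu' vv' uu0 vv0 !(innerC u') uu0; ring.
rewrite frobenius_normZ ger0_norm; last by move: d0 t2; lra.
have : 1 <= frobenius_norm (Q - Q').
  by rewrite -ler_sqr ?nnegrE ?ler01 ?frobenius_norm_ge0 // frobenius_sq QQ expr1n ler1n.
move=> q1; have : d + t / 2 <= (d + t / 2) * frobenius_norm (Q - Q').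
  by rewrite ler_peMr //; move: d0 t2; lra.
by move: t2; lra.
Qed.

End Degenerate.

(** * Sharpness of the coefficient *)

(** The extremal pair: [W = s u' v'^T] is orthogonal to [X] on both sides and keeps [X] nearest to
    [X + W], and [Y] replaces the last triple of [X] by [W]. Then [<Y - X, W> = s^2] and
    [|Y - X|^2 = 2 s^2], while the spectral norm of [W] is at most [s]. *)
Lemma concavity_coeff_lower (R : realType) (n m k : nat) (X : 'M[R]_(n, m)) g :
  (k.+1 < minn n m)%N -> rank_le n m k.+1 X -> 0 < sigma k.+1 X ->
  concavity_bounds nuclear_norm (rank_le n m k.+1) X g ->
  (((2 * sigma k.+1 X)^-1)%:E <= g)%E.
Proof.
move=> km Xk s0 [g0 gP].
have km' : (k < m)%N by lia.
have m0 : (0 < m)%N by lia.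
have [u [v [vv uu Xv Xu /(_ Xk) Xrk]]] := singular_pair X km'.
have [u' [v' [uu' vv' Xu' Xv']]] :=
  @singular_complement _ _ _ X (leq_ltn_trans Xk km).
set s := sigma k.+1 X in s0 uu Xv Xu Xrk *.
rewrite gt_eqF //= in uu.
have s_neq0 : s != 0 by rewrite gt_eqF.
have [B [BB _ XB]] := rank_le_row_isometry km' Xk.
have frB : expanding_frame X B s by [].
pose W := s *: (u' *m v'^T).
have Ws : spectral_norm W <= s.
  by apply: le_trans (spectral_norm_le_frobenius _) _; rewrite frobenius_rank1 // ltW.
have projX : is_proj (rank_le n m k.+1) (X + W) X.
  apply: (is_proj_frame km' frB) => //.
  - by rewrite /W -scalemxAr mulmxA Xu' mul0mx scaler0.
  - have Bv' := expanding_frame_kernel frB s_neq0 Xv'.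
    rewrite /W -scalemxAl -mulmxA (_ : v'^T *m B = 0) ?mulmx0 ?scaler0 //.
    by apply: trmx_inj; rewrite trmx_mul trmxK Bv' trmx0.
  move=> p M; apply: le_trans (spectral_norm_mulmx _ _) _.
  by rewrite ler_wpM2r ?inner_ge0 // ler_sqr ?nnegrE ?sigma_ge0 ?(ltW s0).
pose Y := X - s *: (u *m v^T) + W.
have Yk : rank_le n m k.+1 Y.
  apply: leq_trans (mxrank_add _ _) _; rewrite -[k.+1]addn1 leq_add //.
  rewrite /W scalemxAl; apply: leq_trans (mxrankM_maxl _ _) _; exact: rank_leq_col.
have vv0 : inner v v' = 0.
  apply: (mulfI s_neq0); rewrite mulr0 -innerZl -Xu inner_mulmxl trmxK Xv'.
  by rewrite inner0r.
have YX : Y - X = s *: (u' *m v'^T - u *m v^T).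
  by rewrite /Y /W; apply/matrixP => i j; rewrite !mxE; ring.
have := gP Y (X + W) Yk projX.
rewrite [X + W]addrC addrK dual_norm_nuclear // frobenius_sq YX /W.
rewrite !inner_linear !inner_rank1_rank1 uu vv uu' vv' (innerC v' v) vv0 -/W.
case: g g0 {gP} => [g| |] //= g0; last by rewrite leey.
rewrite -EFinM !lee_fin => h.
have {}h : s ^+ 2 <= g * (spectral_norm W * (2 * s ^+ 2)).
  by move: h; rewrite !mulr0 !mulr1; lra.
rewrite lee_fin in g0.
have : s ^+ 2 <= g * (s * (2 * s ^+ 2)).
  apply: le_trans h _; apply: ler_wpM2l => //; apply: ler_wpM2r => //.
  by rewrite mulr_ge0 ?sqr_ge0.
rewrite (_ : g * _ = s ^+ 2 * (g * (2 * s))); last by ring.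
rewrite -[X in X <= _]mulr1 ler_pM2l ?exprn_gt0 // => h1.
by rewrite -[leLHS]mul1r ler_pdivrMr ?mulr_gt0.
Qed.

Theorem lemma7 (R : realType) (n m r : nat)
    (hr1 : (1 <= r)%N) (hr2 : (r < minn n m)%N)
    (P : 'M[R]_(n, m) -> 'M[R]_(n, m))
    (hP : projection_onto (rank_le n m r) P) :
  [/\ forall Z : 'M[R]_(n, m), dual_norm nuclear_norm Z = spectral_norm Z,
      forall X : 'M[R]_(n, m), rank_le n m r X ->
        local_concavity_coeff nuclear_norm (rank_le n m r) P X =
          (if sigma r X == 0 then +oo%E else ((2 * sigma r X)^-1)%:E)
    & norm_compatible nuclear_norm (rank_le n m r) P 1].
Proof.
case: r hr1 hr2 hP => // k _ km hP.
have km' : (k < m)%N by lia.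
have dual (Z : 'M[R]_(n, m)) : dual_norm nuclear_norm Z = spectral_norm Z.
  by apply: dual_norm_nuclear; lia.
split=> // [X Xk|Z X Xk]; last first.
  by rewrite !dual mul1r; exact: spectral_norm_proj_le (hP Z) Xk.
(* Degeneracy amounts to [sigma k.+1 X = 0]; the two mixed cases are contradictory. *)
rewrite /local_concavity_coeff; case: asboolP => [degX|regX].
  case: eqP => // /eqP s0; case: (regular_not_degenerate km' hP Xk _ degX).
  by rewrite lt_neqAle eq_sym s0 sigma_ge0.
case: eqP => [s0|/eqP s0].
  by case: regX; apply: rank_deficient_degenerate => //; exact: mxrank_sigma0.
have s_gt0 : 0 < sigma k.+1 X by rewrite lt_neqAle eq_sym s0 sigma_ge0.
apply/le_anti/andP; split; last first.
  by apply: le_ereal_inf_tmp => g; exact: concavity_coeff_lower.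
apply: ereal_inf_lbound; split; first by rewrite lee_fin invr_ge0 mulr_ge0 ?sigma_ge0.
move=> Y Z Yk ZX; rewrite -EFinM lee_fin dual.
exact: concavity_coeff_upper.
Qed.
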